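(* Let $d,N\geq 1$. Consider an irreducible, $\mathbb{Z}^d$-invariant, finitely supported Markov chain on the thickened lattice $\mathbb{Z}^d\times\{1,\dots,N\}$ and assume that it is non-centered. Then the Martin compactification coincides with the $\mathrm{CAT}(0)$ compactification of $\mathbb{Z}^d\times\{1,\dots,N\}$, and every point in the Martin boundary is minimal.
   Context: **Chain.** The Markov chain is given by $p((x,k),(y,j))=p_{k,j}(x,y)\ge0$, $x,y\in\mathbb{Z}^d$, $k,j\in\{1,\dots,N\}$, with $\sum_{y,j}p_{k,j}(x,y)=1$ for all $x,k$. It is $\mathbb{Z}^d$-invariant: $p_{k,j}(x,y)=p_{k,j}(0,y-x)$; finitely supported: $p_{k,j}(0,x)\ne0$ for only finitely many $x$; irreducible: for all $x,y,k,j$ there is $n$ with $p^{(n)}_{k,j}(x,y)>0$, where $p^{(n)}$ is the $n$th convolution power. **Centering.** Let $\nu_0$ be the unique stationary probability measure of the induced chain on $\{1,\dots,N\}$, whose transition matrix is $\big(\sum_{x\in\mathbb{Z}^d}p_{k,j}(0,x)\big)_{k,j}$. Put $\overrightarrow{p}=\sum_{x\in\mathbb{Z}^d}\sum_{k,j}\nu_0(k)\,x\,p_{k,j}(0,x)\in\mathbb{R}^d$. The chain is centered if $\overrightarrow{p}=0$, non-centered otherwise. **Martin compactification.** For an irreducible transition kernel $p$ on a countable discrete space $E$ with everywhere finite Green function $G(x,y)=\sum_{n\ge 0}p^{(n)}(x,y)$, fix a base point $x_0$ and set $K(x,y)=G(x,y)/G(x_0,y)$. The Martin compactification is the smallest compact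 space $M$ in which $E$ is open and dense and such that $K$ extends continuously to $E\times M$; the Martin boundary is $M\setminus E$. Equivalently, a compact $M$ containing $E$ as an open dense subset is the Martin compactification if (i) $y_n\to\tilde y$ in $M$ implies that $K(\cdot,y_n)$ converges pointwise to a function $K(\cdot,\tilde y)$, and (ii) distinct boundary points $\tilde y_1\ne\tilde y_2$ give $K(\cdot,\tilde y_1)\neq K(\cdot,\tilde y_2)$. Two compactifications of $E$ coincide if the identity of $E$ extends to a homeomorphism between them. **Minimality.** A function $\phi:E\to\mathbb{R}$ is harmonic if $\phi(x)=\sum_yp(x,y)\phi(y)$ for all $x$. A non-negative harmonic function $\phi$ is minimal if every non-negative harmonic $\psi\le\phi$ is proportional to $\phi$. A boundary point $\tilde y$ is minimal if $K(\cdot,\tilde y)$ is minimal harmonic. **$\mathrm{CAT}(0)$ compactification.** The $\mathrm{CAT}(0)$ compactification of $\mathbb{Z}^d\times\{1,\dots,N\}$ adds a sphere $\mathbb{S}^{d-1}$ at infinity: a sequence $(y_n,k_n)$ converges to $\theta\in\mathbb{S}^{d-1}$ if $\|y_n\|\to\infty$ and $y_n/\|y_n\|\to\theta$ (regardless of $k_n$). *)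

(* Defs.v *)
From HB Require Import structures.
From mathcomp Require Import all_boot all_order all_algebra.
From mathcomp Require Import all_classical all_reals all_analysis.
Set Implicit Arguments.
Unset Strict Implicit.
Unset Printing Implicit Defensive.
Import Order.TTheory GRing.Theory Num.Theory.
Import numFieldNormedType.Exports.
Local Open Scope classical_set_scope.
Local Open Scope ring_scope.

(* Sums over a countable state space are the finitely supported sums of
   fsbigop: they are meant for kernels with finitely many non-zero entries in
   each row, for which every sum below is really finite. *)
Section Kernel.
Context {R : realType} {E : choiceType}.
Implicit Type p : E -> E -> R.

Definition markov_kernel p : Prop :=
  [/\ forall x y, 0 <= p x y,
      forall x, finite_set [set y | p x y != 0] &
      forall x, \sum_(y \in [set: E]) p x y = 1].

Fixpoint nstep p (n : nat) (x y : E) : R :=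
  if n is m.+1 then \sum_(z \in [set: E]) p x z * nstep p m z y
  else (x == y)%:R.

Definition irreducible_kernel p : Prop := forall x y, exists n, 0 < nstep p n x y.

Definition green p (x y : E) : \bar R :=
  (\sum_(0 <= n <oo) (nstep p n x y)%:E)%E.

Definition green_finite p : Prop := forall x y, (green p x y < +oo)%E.

Definition martin_kernel p (x0 x y : E) : R :=
  fine (green p x y) / fine (green p x0 y).

Definition harmonic_function p (phi : E -> R) : Prop :=
  forall x, phi x = \sum_(y \in [set: E]) p x y * phi y.

Definition minimal_harmonic p (phi : E -> R) : Prop :=
  [/\ harmonic_function p phi, forall x, 0 <= phi x &
      forall psi : E -> R, harmonic_function p psi -> (forall x, 0 <= psi x <= phi x) ->
        exists c : R, forall x, psi x = c * phi x].

End Kernel.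

Section Compactification.
Context {R : realType} {E : choiceType}.

(* [iota] embeds the discrete space E as an open dense subset: as E is
   discrete, this amounts to injectivity, density and openness of points. *)
Record compactification (M : topologicalType) (iota : E -> M) : Prop := {
  compactification_compact : compact [set: M] ;
  compactification_hausdorff : hausdorff_space M ;
  compactification_inj : injective iota ;
  compactification_open : forall x, open [set iota x] ;
  compactification_dense : dense (range iota) }.

(* [Kt] is a continuous extension of [K] to E * M; since the factor E is
   discrete, joint continuity is continuity of each section. *)
Definition continuous_extension (K : E -> E -> R) (M : topologicalType)
    (iota : E -> M) (Kt : E -> M -> R) : Prop :=
  (forall x y, Kt x (iota y) = K x y) /\ (forall x, continuous (Kt x)).

(* M, with its extended kernel Kt, is the smallest compactification to which
   the Martin kernel based at x0 extends: every other one maps onto it by a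
   continuous map that is the identity on E. *)
Record martin_compactification (p : E -> E -> R) (x0 : E)
    (M : topologicalType) (iota : E -> M) (Kt : E -> M -> R) : Prop := {
  martin_compact : compactification iota ;
  martin_extension : continuous_extension (martin_kernel p x0) iota Kt ;
  martin_smallest : forall (M' : topologicalType) (iota' : E -> M')
      (Kt' : E -> M' -> R),
    compactification iota' ->
    continuous_extension (martin_kernel p x0) iota' Kt' ->
    exists2 f : M' -> M, continuous f & forall x, f (iota' x) = iota x }.

Definition coincide (M1 M2 : topologicalType)
    (iota1 : E -> M1) (iota2 : E -> M2) : Prop :=
  exists f : M1 -> M2, exists g : M2 -> M1,
    [/\ continuous f, continuous g, cancel f g, cancel g f &
        forall x, f (iota1 x) = iota2 x].

End Compactification.

(* Z^d * {1, ..., N} *)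
Definition thick (d N : nat) : Type := ('rV[int]_d * 'I_N)%type.
HB.instance Definition _ d N := Choice.on (thick d N).

Section Chain.
Context {R : realType} {d N : nat}.
Implicit Type p : thick d N -> thick d N -> R.

Definition lattice_invariant p : Prop :=
  forall (x y : 'rV[int]_d) (k j : 'I_N), p (x, k) (y, j) = p (0, k) (y - x, j).

Definition finitely_supported p : Prop :=
  forall k j : 'I_N, finite_set [set x : 'rV[int]_d | p (0, k) (x, j) != 0].

Definition induced_chain p (k j : 'I_N) : R :=
  \sum_(x \in [set: 'rV[int]_d]) p (0, k) (x, j).

Definition stationary_probability (q : 'I_N -> 'I_N -> R) (nu : 'I_N -> R) :=
  [/\ forall k, 0 <= nu k, \sum_k nu k = 1 &
      forall j, \sum_k nu k * q k j = nu j].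

Definition drift p (nu : 'I_N -> R) : 'rV[R]_d :=
  \sum_(x \in [set: 'rV[int]_d]) \sum_k \sum_j
    (nu k * p (0, k) (x, j)) *: map_mx intr x.

End Chain.

(* The library norm on matrices is the sup norm. *)
Definition enorm {R : realType} {d : nat} (u : 'rV[R]_d) : R :=
  Num.sqrt (\sum_i u 0 i ^+ 2).

Definition sphere (R : realType) (d : nat) : Type :=
  {u : 'rV[R]_d | enorm u == 1}.
HB.instance Definition _ R d := Choice.on (sphere R d).

Definition position {R : realType} {d N : nat} (a : thick d N) : 'rV[R]_d :=
  map_mx intr a.1.

Definition direction {R : realType} {d N : nat} (a : thick d N) : 'rV[R]_d :=
  (enorm (position a : 'rV[R]_d))^-1 *: position a.

Definition cat0 (R : realType) (d N : nat) : Type :=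
  (thick d N + sphere R d)%type.
HB.instance Definition _ R d N := Choice.on (cat0 R d N).

Definition cat0_embed (R : realType) (d N : nat) (a : thick d N) :
  cat0 R d N := inl a.

Section Cat0Topology.
Context {R : realType} {d N : nat}.

(* Lattice points are isolated; a point theta at infinity has as basic
   neighbourhoods, for V a neighbourhood of theta in R^d and r real, the
   directions in V together with the lattice points of norm greater than r
   whose direction is in V. *)
Definition cat0_nbhs (z : cat0 R d N) : set_system (cat0 R d N) :=
  match z with
  | inl a => [set A | A (inl a)]
  | inr theta => [set A | exists (V : set 'rV[R]_d) (r : R),
      [/\ nbhs (val theta) V,
          forall phi : sphere R d, V (val phi) -> A (inr phi) &
          forall a : thick d N, r < enorm (position a : 'rV[R]_d) ->
            V (direction a) -> A (inl a)]]
  end.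

HB.instance Definition _ := hasNbhs.Build (cat0 R d N) cat0_nbhs.

Lemma cat0_nbhs_singleton (z : cat0 R d N) (A : set (cat0 R d N)) :
  nbhs z A -> A z.
Proof.
case: z => [a|theta] //= [V [r [nV VA _]]].
by apply: VA; exact: nbhs_singleton nV.
Qed.

Lemma cat0_nbhs_filter (z : cat0 R d N) : ProperFilter (nbhs z).
Proof.
apply: Build_ProperFilter_ex => [A /cat0_nbhs_singleton Az|]; first by exists z.
case: z => [a|theta]; first by split => //= A B sAB /sAB.
split => /=.
- by exists setT, 0; split => //; exact: filterT.
- move=> A B [V [r [nV VA rA]]] [W [s [nW WB sB]]].
  exists (V `&` W), (Num.max r s); split; first exact: filterI.
    by move=> phi [/VA ? /WB ?].
  move=> a; rewrite gt_max => /andP[ra sa] [Va Wa].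
  by split; [exact: rA | exact: sB].
- move=> A B sAB [V [r [nV VA rA]]]; exists V, r; split => //.
    by move=> phi /VA /sAB.
  by move=> a ra /(rA _ ra) /sAB.
Qed.

Lemma cat0_nbhs_nbhs (z : cat0 R d N) (A : set (cat0 R d N)) :
  nbhs z A -> nbhs z (nbhs^~ A).
Proof.
case: z => [a|theta] //= [V [r [nV VA rA]]].
exists (V°), r; split; first exact: nbhs_interior.
  by move=> phi Vphi; exists V, r.
by move=> a ra Va; apply: rA => //; exact: interior_subset Va.
Qed.

HB.instance Definition _ := Nbhs_isNbhsTopological.Build (cat0 R d N)
  cat0_nbhs_filter cat0_nbhs_singleton cat0_nbhs_nbhs.

Lemma cat0_cvgP (y : nat -> thick d N) (theta : sphere R d) :
  (cat0_embed R (y n) @[n --> \oo] --> (inr theta : cat0 R d N)) <->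
  (enorm (position (y n) : 'rV[R]_d) @[n --> \oo] --> +oo) /\
  ((direction (y n) : 'rV[R]_d) @[n --> \oo] --> val theta).
Proof.
split=> [yt|[yoo yt] A [V [r [nV VA rA]]]].
  split.
    apply/cvgryPgt => r.
    apply: (yt [set z | if z is inl a then r < enorm (position a : 'rV[R]_d)
                        else True]).
    by exists setT, r; split => //; exact: filterT.
  move=> V nV.
  apply: (yt [set z | if z is inl a then V (direction a) else True]).
  by exists V, 0; split.
have /cvgryPgt/(_ r) yr := yoo.
have {}yV : \forall n \near \oo, V (direction (y n)) by exact: yt.
by apply: filterS2 yr yV => n; exact: rA.
Qed.

End Cat0Topology.

(* Main.v *)
Require Import Defs.
From HB Require Import structures.
From mathcomp Require Import all_boot all_order all_algebra.
From mathcomp Require Import all_classical all_reals all_analysis.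
From mathcomp Require Import ring lra zify.
Import Order.TTheory GRing.Theory Num.Theory.
Import numFieldNormedType.Exports.
Local Open Scope classical_set_scope.
Local Open Scope ring_scope.
Set Implicit Arguments.
Unset Strict Implicit.
Unset Printing Implicit Defensive.

(* Summing out the lattice, exponentials [exp (u . x) * phi k] turn the chain into
   a family of nonnegative matrices. For a unit vector theta, let u maximise
   [u . theta] among the exponents admitting a positive superharmonic function
   [exp (u . x) * phi k]. Irreducibility makes the optimal function h harmonic, and
   perturbing u shows that the Doob transform by h escapes in the direction theta;
   its velocity is nonzero because the chain, being non-centered, has a strictly
   contracting exponent. It remains to see that the Green function g of a chain
   with velocity parallel to theta satisfies [g (x, y) / g (x', y) --> 1] as y tends
   to theta. This replaces the local limit theorem by three soft facts.
   - Let q be an average of powers of the chain charging both the jump 0 and the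
     jump e. Marking these two kinds of jumps by -1 and +1, the expected mark up to
     time n on the event of being at y is a multiple of
     [n (q^(n-1) (x + e, y) - q^(n-1) (x, y))]; since the mark is at most
     [ep * n] outside an event of exponentially small probability, the difference
     is at most [ep * q^n (x, y) + C rho^n].
   - By the law of large numbers g (x', y) decays subexponentially as y tends to
     theta, so the error terms are negligible and g is almost invariant under
     translations by e.
   - Hence g is almost a harmonic function of the type alone, that is, a constant.
   The first fact also shows that bounded harmonic functions are constant, which
   gives minimality of h; and h determines theta, since it determines the velocity
   of the transformed chain. *)

(** * Positive operators *)

Section PositiveOperators.
Context {R : realType} {T : Type}.
Implicit Types (A B : (T -> R) -> T -> R) (f g : T -> R).

(** Operators act on arbitrary functions, without summability conditions, which is harmless for
    jumps of finite range. The same interface serves the chain, its powers and averages, and the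
    marked walk on [R * E]. *)
Record positive_operator A : Prop := PositiveOperator {
  posop_linear : forall (l : R) f g x,
    A (fun y => l * f y + g y) x = l * A f x + A g x;
  posop_ge0 : forall f, (forall y, 0 <= f y) -> forall x, 0 <= A f x }.

Section Theory.
Context A (posA : positive_operator A).

Lemma posop0 x : A (fun=> 0) x = 0.
Proof.
have := posop_linear posA 1 (fun=> 0) (fun=> 0) x.
by rewrite mulr0 addr0 mul1r; lra.
Qed.

Lemma posopZ l f x : A (fun y => l * f y) x = l * A f x.
Proof.
rewrite -[RHS]addr0 -(posop0 x) -(posop_linear posA).
by congr (A _ x); apply: funext => y; rewrite addr0.
Qed.

Lemma posopD f g x : A (fun y => f y + g y) x = A f x + A g x.
Proof.
rewrite -[A f x]mul1r -(posop_linear posA).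
by congr (A _ x); apply: funext => y; rewrite mul1r.
Qed.

Lemma posopB f g x : A (fun y => f y - g y) x = A f x - A g x.
Proof.
rewrite addrC -mulN1r -(posop_linear posA).
by congr (A _ x); apply: funext => y; rewrite mulN1r addrC.
Qed.

Lemma posop_sum (I : Type) (r : seq I) (F : I -> T -> R) x :
  A (fun y => \sum_(i <- r) F i y) x = \sum_(i <- r) A (F i) x.
Proof.
elim: r => [|i r IHr].
  rewrite big_nil -[RHS](posop0 x); congr (A _ x).
  by apply: funext => y; rewrite big_nil.
rewrite big_cons -IHr -posopD.
suff -> : (fun y => \sum_(j <- i :: r) F j y) = (fun y => F i y + \sum_(j <- r) F j y) by [].
by apply: funext => y; rewrite big_cons.
Qed.

Lemma posop_le f g : (forall y, f y <= g y) -> forall x, A f x <= A g x.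
Proof.
move=> fg x; rewrite -subr_ge0 -posopB.
by apply: (posop_ge0 posA) => y; rewrite subr_ge0.
Qed.

Lemma posop_iter n : positive_operator (iter n A).
Proof.
elim: n => [|n IHn]; first by split.
split => [l f g x|f f_ge0 x] /=.
  rewrite -(posop_linear posA); congr (A _ x).
  by apply: funext => y; exact: (posop_linear IHn).
by apply: (posop_ge0 posA) => y; exact: (posop_ge0 IHn).
Qed.

Lemma posop_iter_superharmonic f : (forall x, A f x <= f x) ->
  forall n x, iter n A f x <= f x.
Proof.
move=> fA; elim=> [//|n IHn] x /=.
by apply: le_trans (fA x); exact: posop_le.
Qed.

Lemma posop_iter_eigen l f : (forall x, A f x = l * f x) ->
  forall n x, iter n A f x = l ^+ n * f x.
Proof.
move=> fA; elim=> [|n IHn] x /=; first by rewrite mul1r.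
by rewrite (funext IHn) posopZ fA mulrA exprSr.
Qed.

Lemma posop_iter_le_eigen l f : 0 <= l -> (forall x, A f x <= l * f x) ->
  forall n x, iter n A f x <= l ^+ n * f x.
Proof.
move=> l_ge0 fA; elim=> [|n IHn] x; first by rewrite mul1r.
rewrite iterS; apply: le_trans (posop_le IHn x) _.
by rewrite posopZ exprSr -mulrA ler_wpM2l ?exprn_ge0.
Qed.

End Theory.
End PositiveOperators.

Section Translations.
Context {R : realType} {d N : nat}.
Local Notation E := (thick d N).
Implicit Types (A : (E -> R) -> E -> R) (f : E -> R).

Definition translate (e : 'rV[int]_d) (x : E) : E := (x.1 + e, x.2).

Definition translation_invariant A : Prop :=
  forall e f x, A (fun y => f (translate e y)) x = A f (translate e x).

Lemma translation_invariant_iter A n :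
  translation_invariant A -> translation_invariant (iter n A).
Proof.
move=> trA e f; elim: n => [//|n IHn] x /=.
by rewrite (funext IHn) trA.
Qed.

End Translations.

(** * Exponential inequalities *)

Section RealBounds.
Context {R : realType}.

(** From [1 - s <= expR (- s)] follows [(1 - s) * expR s <= 1], while [(1 + s + 2 * s ^+ 2) * (1 -
    s) = 1 + s ^+ 2 * (1 - 2 * s)] is at least 1. *)
Lemma ler_expR_quad (s : R) : s <= 1/2 -> expR s <= 1 + s + 2 * s ^+ 2.
Proof.
move=> s_le; have := expR_ge1Dx (- s); rewrite expRN => le_inv.
have es_gt0 := expR_gt0 s.
have : (1 - s) * expR s <= 1 by rewrite -ler_pdivlMr // mul1r.
have quad : 1 <= (1 + s + 2 * s ^+ 2) * (1 - s) by nra.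
have : 0 < 1 - s by lra.
move=> h1 h2; rewrite -(ler_pM2r h1) [expR s * _]mulrC.
exact: le_trans quad.
Qed.

(** Chernoff-type bound on the excess of [|b|] over [r]. It replaces the absolute value of the mark
    by exponentials, which are eigenfunctions of the marked walk. *)
Lemma ler_expR_tilt (s r b : R) : 0 < s ->
  `|b| <= r + s^-1 * expR (- (s * r)) * (expR (s * b) + expR (- (s * b))).
Proof.
move=> s_gt0; have step : `|b| - r <= s^-1 * expR (s * (`|b| - r)).
  rewrite -[leLHS](mulKf (lt0r_neq0 s_gt0)) ler_pM2l ?invr_gt0 //.
  by have := expR_ge1Dx (s * (`|b| - r)); lra.
rewrite -lerBlDl; apply: le_trans step _.
rewrite -[leRHS]mulrA ler_pM2l ?invr_gt0 // mulrBr addrC expRD.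
rewrite ler_pM2l ?expR_gt0 //.
case: (ger0P b) => _; first by rewrite lerDl expR_ge0.
by rewrite mulrN lerDr expR_ge0.
Qed.

End RealBounds.

(** * Marked jumps and the ratio estimate *)

Section MarkedWalk.
Context {R : realType} {d N : nat}.
Local Notation E := (thick d N).
Context (q : (E -> R) -> E -> R) (posq : positive_operator q)
  (trq : translation_invariant q) (q1 : forall x, q (fun=> 1) x = 1).
Context (al : R) (e : 'rV[int]_d) (al_gt0 : 0 < al)
  (q_low : forall f, (forall y, 0 <= f y) -> forall x,
    al * (f x + f (translate e x)) <= q f x).

(* Out of the jumps of q we single out the jump 0 and the jump e, each carrying
   weight al; the mark, a real number, decreases by 1 with the former and
   increases by 1 with the latter. *)
Let V (g : R * E -> R) (z : R * E) : R :=
  q (fun y => g (z.1, y)) z.2 - al * (g z + g (z.1, translate e z.2))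
  + al * (g (z.1 - 1, z.2) + g (z.1 + 1, translate e z.2)).

Let posV : positive_operator V.
Proof.
split => [l f g [b x]|f f_ge0 [b x]]; rewrite /V /=.
  by rewrite (posop_linear posq); ring.
apply: addr_ge0; first by rewrite subr_ge0; apply: q_low => y.
by rewrite mulr_ge0 ?addr_ge0 // ltW.
Qed.

Let V_affine (F H : E -> R) z : V (fun w => w.1 * F w.2 + H w.2) z =
  z.1 * q F z.2 + (al * (F (translate e z.2) - F z.2) + q H z.2).
Proof. by case: z => b x; rewrite /V /= (posop_linear posq); ring. Qed.

Let iterV_unmarked (F : E -> R) n z : iter n V (fun w => F w.2) z = iter n q F z.2.
Proof.
elim: n z => [//|n IHn] z /=; rewrite (funext IHn).
by case: z => b x; rewrite /V /=; ring.
Qed.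

(* The expected mark, restricted to the target F, is a discrete derivative. *)
Let iterV_mark (F : E -> R) n z : iter n.+1 V (fun w => w.1 * F w.2) z =
  z.1 * iter n.+1 q F z.2 +
  n.+1%:R * al * (iter n q F (translate e z.2) - iter n q F z.2).
Proof.
elim: n z => [|n IHn] z.
  have -> : (fun w : R * E => w.1 * F w.2) = (fun w => w.1 * F w.2 + 0).
    by apply: funext => w; rewrite addr0.
  by rewrite [LHS](V_affine F (fun=> 0)) posop0 //= mul1r addr0.
rewrite iterS (funext IHn).
rewrite (V_affine _ (fun x => n.+1%:R * al * (iter n q F (translate e x) - iter n q F x))).
have -> : n.+2%:R = n.+1%:R + 1 :> R by rewrite natr1.
by rewrite posopZ // posopB // trq /=; ring.
Qed.

(** Without a target, each jump carries the mark 1 or -1 with weight [al] independently of the past,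
    so it multiplies the exponential moment by a fixed factor. *)
Let iterV_exp (s : R) n z : iter n V (fun w => expR (s * w.1)) z =
  (1 + al * (expR s + expR (- s) - 2)) ^+ n * expR (s * z.1).
Proof.
apply: (posop_iter_eigen posV) => -[b x]; rewrite /V /=.
have -> : q (fun=> expR (s * b)) x = expR (s * b).
  have -> : (fun=> expR (s * b)) = (fun _ : E => expR (s * b) * 1).
    by apply: funext => y; rewrite mulr1.
  by rewrite posopZ // q1 mulr1.
have -> : expR (s * (b - 1)) = expR (s * b) * expR (- s).
  by rewrite mulrBr mulr1 expRD.
have -> : expR (s * (b + 1)) = expR (s * b) * expR s.
  by rewrite mulrDr mulr1 expRD.
by ring.
Qed.

(** The left side is the signed expected mark on the target [f]. [ler_expR_tilt] splits the mark at
    [ep * n.+1%:R], and [f <= 1] lets the target be dropped from the excess. The sign [sg] yields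
    both halves of an absolute value. *)
Let mark_bound (f : E -> R) (ep s sg : R) n x : 0 < s -> `|sg| = 1 ->
  (forall y, 0 <= f y <= 1) ->
  sg * (n.+1%:R * al * (iter n q f (translate e x) - iter n q f x)) <=
  ep * n.+1%:R * iter n.+1 q f x +
    s^-1 * expR (- (s * (ep * n.+1%:R))) *
    (2 * (1 + al * (expR s + expR (- s) - 2)) ^+ n.+1).
Proof.
move=> s_gt0 sg1 f01.
set r := ep * n.+1%:R; set t := s^-1 * _.
pose g1 := fun w : R * E => sg * (w.1 * f w.2) + 0.
pose g2 := fun w : R * E => r * f w.2 + t * (expR (s * w.1) + expR ((- s) * w.1)).
have g12 w : g1 w <= g2 w.
  rewrite /g1 /g2 addr0; have /andP[f_ge0 f_le1] := f01 w.2.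
  have t_ge0 : 0 <= t * (expR (s * w.1) + expR ((- s) * w.1)).
    by rewrite !mulr_ge0 ?invr_ge0 ?(ltW s_gt0) ?expR_ge0 // addr_ge0 ?expR_ge0.
  apply: (@le_trans _ _ (`|w.1| * f w.2)).
    rewrite mulrA ler_wpM2r //; apply: le_trans (ler_norm _) _.
    by rewrite normrM sg1 mul1r.
  have := ler_expR_tilt r w.1 s_gt0; rewrite -/t => b_le.
  apply: (@le_trans _ _ ((r + t * (expR (s * w.1) + expR ((- s) * w.1))) * f w.2)).
    by rewrite ler_wpM2r // mulNr.
  by rewrite mulrDl lerD2l ler_piMr.
have := posop_le (posop_iter posV n.+1) g12 (0, x).
rewrite (posop_linear (posop_iter posV n.+1)) (posop0 (posop_iter posV n.+1)).
rewrite iterV_mark mul0r add0r addr0 /= => /le_trans; apply.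
have := posop_linear (posop_iter posV n.+1) r (fun w => f w.2)
  (fun w => t * (expR (s * w.1) + expR ((- s) * w.1))) (0, x).
rewrite -/g2 -[iter _ V g2 _]/(V (iter n V g2) (0, x)) => ->.
rewrite (posopZ (posop_iter posV n.+1)) (posopD (posop_iter posV n.+1)).
rewrite iterV_unmarked !iterV_exp !mulr0 expR0 !mulr1 opprK /=.
by rewrite [expR (- s) + expR s]addrC mulr2n mulrDl mul1r.
Qed.

Lemma ratio_bound (ep : R) : 0 < ep -> exists C rho : R,
  [/\ 0 <= C, 0 <= rho, rho < 1 & forall f, (forall y, 0 <= f y <= 1) ->
    forall n x, `|iter n q f (translate e x) - iter n q f x| <=
      ep * iter n.+1 q f x + C * rho ^+ n].
Proof.
move=> ep_gt0.
(* Per jump, the exponential moment grows by [lam <= expR (4 * al * s ^+ 2)] and the tilt gains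
   [expR (- (s * ep * al))]; [4 * s < ep] makes the product [rho] smaller than 1. *)
have [s [s_gt0 s_le s_ep]] : exists s : R, [/\ 0 < s, s <= 1/2 & 4 * s < ep].
  pose s := Num.min (1/2) (ep / 8).
  have s_le : s <= 1/2 by rewrite ge_min lexx.
  have s_ep : s <= ep / 8 by rewrite ge_min lexx orbT.
  by exists s; split => //; [rewrite lt_min; apply/andP; split; lra | lra].
pose lam := 1 + al * (expR s + expR (- s) - 2).
pose rho := expR (- (s * (ep * al))) * lam.
have cosh_ge : 0 <= expR s + expR (- s) - 2.
  by have := expR_ge1Dx s; have := expR_ge1Dx (- s); lra.
have cosh_le : expR s + expR (- s) - 2 <= 4 * s ^+ 2.
  have := ler_expR_quad s_le; have : - s <= 1/2 by lra.
  by move/ler_expR_quad; rewrite sqrrN; lra.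
have lam_ge1 : 1 <= lam by rewrite /lam lerDl mulr_ge0 // ltW.
have lam_le : lam <= expR (al * (4 * s ^+ 2)).
  apply: le_trans (expR_ge1Dx _); rewrite lerD2l.
  by rewrite ler_pM2l.
have rho_lt1 : rho < 1.
  apply: (@le_lt_trans _ _ (expR (- (s * (ep * al)) + al * (4 * s ^+ 2)))).
    by rewrite expRD ler_pM2l ?expR_gt0.
  rewrite expR_lt1.
  have -> : - (s * (ep * al)) + al * (4 * s ^+ 2) = - (s * al * (ep - 4 * s)) by ring.
  by rewrite oppr_lt0 !mulr_gt0 // subr_gt0.
have rho_ge0 : 0 <= rho by rewrite mulr_ge0 ?expR_ge0 //; lra.
exists (2 / (s * al)), rho; split => // [|f f01 n x].
  by rewrite divr_ge0 // mulr_ge0 // ltW.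
set D := iter n q f _ - _.
have n_gt0 : 0 < n.+1%:R :> R by rewrite ltr0n.
have n_ge1 : 1 <= n.+1%:R :> R by rewrite ler1n.
(* [mark_bound] is applied with [ep * al], so that the factor [n.+1%:R * al] of the discrete
   derivative cancels. *)
have key sg : `|sg| = 1 -> sg * D <= ep * iter n.+1 q f x + 2 / (s * al) * rho ^+ n.
  move=> sg1; have := mark_bound (ep * al) n x s_gt0 sg1 f01; rewrite -/D -/lam.
  have -> : s^-1 * expR (- (s * (ep * al * n.+1%:R))) * (2 * lam ^+ n.+1) =
            2 / s * rho ^+ n.+1.
    rewrite /rho exprMn -expRM_natr mulNr; rewrite !mulrA; ring.
  move=> hb.
  have rhoS : rho ^+ n.+1 <= rho ^+ n by rewrite exprS ler_piMl ?exprn_ge0 // ltW.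
  rewrite -(ler_pM2l n_gt0) -(ler_pM2l al_gt0).
  apply: (@le_trans _ _ (ep * al * n.+1%:R * iter n.+1 q f x + 2 / s * rho ^+ n.+1)).
    by apply: le_trans hb; rewrite le_eqVlt; apply/orP; left; apply/eqP; ring.
  rewrite mulrDr mulrDr.
  have -> : al * (n.+1%:R * (ep * iter n.+1 q f x)) = ep * al * n.+1%:R * iter n.+1 q f x.
    by ring.
  rewrite lerD2l.
  have -> : al * (n.+1%:R * (2 / (s * al) * rho ^+ n)) = n.+1%:R * (2 / s * rho ^+ n).
    by field; rewrite !lt0r_neq0.
  have s2 : 0 <= 2 / s by rewrite divr_ge0 // ltW.
  apply: (@le_trans _ _ (2 / s * rho ^+ n)); first by rewrite ler_wpM2l.
  by rewrite ler_peMl // mulr_ge0 // exprn_ge0.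
rewrite ler_norml; apply/andP; split.
  by rewrite lerNl -mulN1r key // normrN normr1.
by rewrite -[D]mul1r key // normr1.
Qed.

End MarkedWalk.

(** The minimum of finitely many constants works for all indices. This makes Harnack constants
    uniform over types and over finitely many displacements. *)
Lemma finite_uniform {R : realType} (I : finType) (Q : I -> R -> Prop) :
  (forall i r r', Q i r -> 0 < r' -> r' <= r -> Q i r') ->
  (forall i, exists2 r, 0 < r & Q i r) -> exists2 r, 0 < r & forall i, Q i r.
Proof.
move=> Qle Qex.
suff [r r_gt0 Qr] : exists2 r, 0 < r & forall i, i \in enum I -> Q i r.
  by exists r => // i; apply: Qr; rewrite mem_enum.
elim: (enum I) => [|i s [r r_gt0 IHs]]; first by exists 1.
have [r' r'_gt0 Qr'] := Qex i.
have min_gt0 : 0 < Num.min r r' by rewrite lt_min r_gt0.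
exists (Num.min r r') => // j; rewrite inE => /predU1P[->|/IHs Qj].
  by apply: Qle Qr' _ _ => //; rewrite ge_min lexx orbT.
by apply: Qle Qj _ _ => //; rewrite ge_min lexx.
Qed.

(** * Walks on the thickened lattice: Harnack inequality and velocity *)

Section Walk.
Context {R : realType} {d N : nat}.
Local Notation E := (thick d N).
Implicit Types (c : 'I_N -> E -> R) (f g : E -> R) (phi : 'I_N -> R) (x y : E).

Definition delta y x : R := (x == y)%:R.

(** A jump adds its displacement but overwrites the type: [a.2] is the type of arrival. As weights
    depend only on the type of departure, [step_op] is translation invariant by construction. *)
Definition shift x a : E := (x.1 + a.1, a.2).

Definition step_op (S : seq E) c f x : R := \sum_(a <- S) c x.2 a * f (shift x a).

Definition type_op (S : seq E) c phi k : R := \sum_(a <- S) c k a * phi a.2.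

Definition superharmonic (P : (E -> R) -> E -> R) f : Prop :=
  (forall x, 0 <= f x) /\ (forall x, P f x <= f x).

Record irreducible_walk (S : seq E) c : Prop := IrreducibleWalk {
  walk_ge0 : forall k a, 0 <= c k a ;
  walk_irreducible : forall x y, exists n, 0 < iter n (step_op S c) (delta y) x }.

Definition stochastic (S : seq E) c : Prop := forall k, \sum_(a <- S) c k a = 1.

Lemma delta_ge0 y x : 0 <= delta y x. Proof. exact: ler0n. Qed.

Lemma delta_le1 y x : delta y x <= 1. Proof. by rewrite /delta; case: eqP. Qed.

Lemma shift_translate e x a : shift (translate e x) a = translate e (shift x a).
Proof. by rewrite /shift /translate /= addrAC. Qed.

Section Theory.
Context (S : seq E) c (c_walk : irreducible_walk S c).
Local Notation P := (step_op S c).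

Lemma step_posop : positive_operator P.
Proof.
split => [l f g x|f f_ge0 x].
  rewrite /step_op big_distrr -big_split; apply: eq_bigr => a _ /=.
  by rewrite mulrDr mulrCA.
by apply: sumr_ge0 => a _; rewrite mulr_ge0 // (walk_ge0 c_walk).
Qed.

Lemma step_translate : translation_invariant P.
Proof.
move=> e f x; rewrite /step_op; apply: eq_bigr => a _.
by rewrite shift_translate.
Qed.

Lemma step_types phi x : P (fun y => phi y.2) x = type_op S c phi x.2.
Proof. by []. Qed.

(** If [n] steps lead from [x] to [y] with weight [ka], then [f x] dominates the [n]-th iterate at
    [x], hence its part [ka * f y]. *)
Lemma harnack x y : exists2 ka, 0 < ka &
  forall f, superharmonic P f -> ka * f y <= f x.
Proof.
have [n n_gt0] := walk_irreducible c_walk x y.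
exists (iter n P (delta y) x) => // f [f_ge0 Pf].
apply: le_trans (posop_iter_superharmonic step_posop Pf n x).
rewrite mulrC -(posopZ (posop_iter step_posop n)).
apply: (posop_le (posop_iter step_posop n)) => z; rewrite /delta.
by case: eqP => [->|_]; rewrite ?mulr1 ?mulr0.
Qed.

Lemma superharmonic_translate e f : superharmonic P f ->
  superharmonic P (fun y => f (translate e y)).
Proof.
move=> [f_ge0 Pf]; split => [x|x]; first exact: f_ge0.
by rewrite step_translate.
Qed.

(** Translating [f] brings [x] to the origin, after which only finitely many pairs of types
    remain. *)
Lemma harnack_shift (e : 'rV[int]_d) : exists2 ka, 0 < ka &
  forall f, superharmonic P f ->
  forall (x : 'rV[int]_d) k j, ka * f (x + e, j) <= f (x, k).
Proof.
have [ka ka_gt0 ka_le] : exists2 ka, 0 < ka & forall kj : 'I_N * 'I_N,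
    forall f, superharmonic P f -> ka * f (e, kj.2) <= f (0, kj.1).
  apply: finite_uniform => [kj r r' Qr r'_gt0 r'_le f fP|[k j]].
    by apply: le_trans (Qr f fP); rewrite ler_wpM2r //; case: fP.
  exact: harnack.
exists ka => // f fP x k j.
have := ka_le (k, j) _ (superharmonic_translate x fP).
by rewrite /translate /= add0r addrC.
Qed.

Lemma superharmonic_gt0 f y : superharmonic P f -> 0 < f y -> forall x, 0 < f x.
Proof.
move=> fP fy x; have [ka ka_gt0 /(_ f fP)] := harnack x y.
by apply: lt_le_trans; rewrite mulr_gt0.
Qed.

End Theory.

Lemma ex_argmax (k0 : 'I_N) phi : exists k, forall j, phi j <= phi k.
Proof.
by case: (@Order.TotalTheory.arg_maxP _ R _ k0 xpredT phi isT) => k _ k_max;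
  exists k => j; exact: k_max.
Qed.

Section Stochastic.
Context (S : seq E) c (c_walk : irreducible_walk S c) (c_stoch : stochastic S c).
Local Notation P := (step_op S c).

Lemma step_cst l x : P (fun=> l) x = l.
Proof. by rewrite /step_op -big_distrl /= c_stoch mul1r. Qed.

Lemma type_op_le_max phi k : (forall j, phi j <= phi k) -> type_op S c phi k <= phi k.
Proof.
move=> k_max; rewrite -[leRHS](step_cst (phi k) (0, k)).
rewrite -[leLHS](step_types S c phi (0, k)).
by apply: (posop_le (step_posop c_walk)) => y; exact: k_max.
Qed.

(** Strong maximum principle: [phi m - phi] is superharmonic and vanishes at the maximal type [m],
    so Harnack makes it vanish everywhere. *)
Lemma type_harmonic_cst phi : (forall k, type_op S c phi k = phi k) ->
  forall j k, phi j = phi k.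
Proof.
move=> phiP j k; have [m m_max] := ex_argmax j phi.
suff phim i : phi i = phi m by rewrite !phim.
pose f (x : E) := phi m - phi x.2.
have fP : superharmonic P f.
  split => [x|x]; first by rewrite subr_ge0.
  by rewrite /f (posopB (step_posop c_walk)) step_cst step_types phiP.
have [ka ka_gt0 /(_ f fP)] := harnack c_walk (0, m) (0, i).
rewrite /f /= subrr pmulr_rle0 // subr_le0 => mi.
by apply/eqP; rewrite eq_le m_max mi.
Qed.

(** The matrix of [phi - type_op phi + phi k0]. Identity minus transition kills the constants; the
    rank-one term restores invertibility. *)
Let poisson_mx (k0 : 'I_N) : 'M[R]_N := \matrix_(k, j)
  ((k == j)%:R - \sum_(a <- S) c k a * (a.2 == j)%:R + (j == k0)%:R).

Let poisson_mxE k0 phi k :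
  \sum_j poisson_mx k0 k j * phi j = phi k - type_op S c phi k + phi k0.
Proof.
transitivity (\sum_j (k == j)%:R * phi j
    - \sum_j (\sum_(a <- S) c k a * (a.2 == j)%:R) * phi j
    + \sum_j (j == k0)%:R * phi j).
  rewrite -sumrB -big_split; apply: eq_bigr => j _; rewrite mxE /=.
  by rewrite mulrDl mulrBl.
have pick (i : 'I_N) (F : 'I_N -> R) : \sum_j (i == j)%:R * F j = F i.
  rewrite (bigD1 i) //= eqxx mul1r big1 ?addr0 // => j /negbTE.
  by rewrite eq_sym => ->; rewrite mul0r.
congr (_ - _ + _); first exact: pick.
  under eq_bigr => j _ do rewrite big_distrl /=.
  rewrite exchange_big /=; apply: eq_bigr => a _.
  by rewrite -[in RHS](pick a.2 phi) big_distrr /=; apply: eq_bigr => j _; rewrite mulrA.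
by rewrite -[RHS]pick; apply: eq_bigr => j _; rewrite eq_sym.
Qed.

Let poisson_mx_unit k0 : poisson_mx k0 \in unitmx.
Proof.
rewrite -unitmx_tr -row_free_unit -kermx_eq0; apply/eqP/row_matrixP => i.
set u := row i _; rewrite row0.
have uB : u *m (poisson_mx k0)^T = 0 by apply/sub_kermxP; exact: row_sub.
pose phi j := u 0 j.
have phiB k : phi k - type_op S c phi k + phi k0 = 0.
  have /rowP/(_ k) := uB; rewrite mxE [RHS]mxE => <-.
  by rewrite -poisson_mxE; apply: eq_bigr => j _; rewrite [_^T _ _]mxE mulrC.
(* The defect is nonnegative at a maximum [m], which gives [phi k0 <= 0], and nonpositive at a
   minimum [m'], which gives the converse. *)
have phi0 : phi k0 = 0.
  have [m m_max] := ex_argmax k0 phi.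
  have [m' m'_max] := ex_argmax k0 (fun k => - phi k).
  have := type_op_le_max m_max; have := type_op_le_max m'_max.
  have := phiB m; have := phiB m'.
  have -> : type_op S c (fun k => - phi k) m' = - type_op S c phi m'.
    by rewrite /type_op -sumrN; apply: eq_bigr => a _; rewrite mulrN.
  by lra.
have phi_harm k : type_op S c phi k = phi k by have := phiB k; rewrite phi0; lra.
apply/rowP => j; rewrite [RHS]mxE.
by rewrite -[LHS]/(phi j) (type_harmonic_cst phi_harm j k0).
Qed.

Let poisson_inv k0 phi k : phi k =
  \sum_j invmx (poisson_mx k0) k j * (phi j - type_op S c phi j + phi k0).
Proof.
pose u := \col_j phi j.
transitivity ((invmx (poisson_mx k0) *m (poisson_mx k0 *m u)) k 0).
  by rewrite mulKmx ?poisson_mx_unit // mxE.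
rewrite [LHS]mxE; apply: eq_bigr => j _.
suff -> : (poisson_mx k0 *m u) j 0 = phi j - type_op S c phi j + phi k0 by [].
by rewrite -poisson_mxE mxE; apply: eq_bigr => i _; rewrite [u _ _]mxE.
Qed.

(** Quantitative maximum principle: an almost harmonic function of the type is almost constant. The
    inverse Poisson matrix is applied to [phi - phi k0], for which the rank-one term vanishes. *)
Lemma type_defect_inverse k0 : exists b : 'I_N -> 'I_N -> R, forall phi k,
  phi k - phi k0 = \sum_j b k j * (phi j - type_op S c phi j).
Proof.
exists (invmx (poisson_mx k0)) => phi k.
rewrite [LHS](poisson_inv k0 (fun k => phi k - phi k0)); apply: eq_bigr => j _.
congr (_ * _); rewrite subrr addr0 /type_op.
under [in LHS]eq_bigr => a _ do rewrite mulrBr.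
by rewrite sumrB -big_distrl /= c_stoch mul1r; lra.
Qed.

(* The affine function [x + G k] has constant drift v under the chain. *)
Definition mean_velocity (v : 'rV[R]_d) (G : 'I_N -> 'rV[R]_d) : Prop :=
  forall k, \sum_(a <- S) c k a *: (position a + G a.2 - G k) = v.

(** With [F] the mean displacement from each type, [X - type_op X + X k0 = F] is solvable; the rows
    of [X] are the corrections and the row [k0] is the velocity. *)
Lemma mean_velocity_exists (k0 : 'I_N) : exists v G, mean_velocity v G.
Proof.
pose F := \matrix_(k, i) (\sum_(a <- S) c k a *: position a) 0 i : 'M[R]_(N, d).
pose X := invmx (poisson_mx k0) *m F.
exists (row k0 X), (fun k => row k X) => k; apply/rowP => i.
have BX : poisson_mx k0 *m X = F by rewrite mulKVmx // poisson_mx_unit.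
have := congr1 (fun A : 'M[R]_(N, d) => A k i) BX.
rewrite /= [in LHS]mxE [in RHS]mxE poisson_mxE /type_op => BXki.
rewrite [RHS]mxE.
have -> : X k0 i = (\sum_(a <- S) c k a *: position a) 0 i - X k i
    + \sum_(a <- S) c k a * X a.2 i by rewrite -BXki; lra.
rewrite !summxE -[X k i]mul1r -(c_stoch k) big_distrl -sumrB -big_split /=.
by apply: eq_bigr => a _; rewrite !mxE; ring.
Qed.

End Stochastic.
End Walk.

(** * Geometric estimates, sums of operators and finite range *)

Lemma geometric_eventually_lt {R : realType} (C rho ep : R) :
  0 <= rho -> rho < 1 -> 0 < ep ->
  exists n0, forall n, (n0 <= n)%N -> C * rho ^+ n < ep.
Proof.
move=> rho_ge0 rho_lt1 ep_gt0.
have rho_norm : `|rho| < 1 by rewrite ger0_norm.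
have /cvgr0Pnorm_lt/(_ _ ep_gt0) := cvg_geometric C rho_norm.
case=> n0 _ n0P; exists n0 => n /n0P; rewrite /geometric /= => /(le_lt_trans _); apply.
exact: ler_norm.
Qed.

Lemma le_of_geometric {R : realType} (a b C rho : R) : 0 <= rho -> rho < 1 ->
  (forall n, a <= b + C * rho ^+ n) -> a <= b.
Proof.
move=> rho_ge0 rho_lt1 ab; rewrite leNgt; apply/negP => ba.
have ba_gt0 : 0 < a - b by rewrite subr_gt0.
have [n /(_ n (leqnn _))] := geometric_eventually_lt C rho_ge0 rho_lt1 ba_gt0.
by have := ab n; lra.
Qed.

Lemma geometric_tail_le {R : realType} (rho : R) n0 M : 0 <= rho -> rho < 1 ->
  \sum_(i < M) (if (n0 <= i)%N then rho ^+ i else 0) <= rho ^+ n0 / (1 - rho).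
Proof.
move=> rho_ge0 rho_lt1; have rho'_gt0 : 0 < 1 - rho by rewrite subr_gt0.
(* The subtracted term is what makes the induction on [M] close. *)
suff : \sum_(i < M) (if (n0 <= i)%N then rho ^+ i else 0) <=
    (rho ^+ n0 - if (n0 <= M)%N then rho ^+ M else rho ^+ n0) / (1 - rho).
  move=> /le_trans; apply; rewrite ler_pM2r ?invr_gt0 // gerBl.
  by case: ifP => _; rewrite exprn_ge0.
elim: M => [|M IHM].
  by rewrite big_ord0 leqn0; case: eqP => [->|_]; rewrite subrr mul0r.
rewrite big_ord_recr /=; have [n0M|n0M] := leqP n0 M.
  rewrite (leqW n0M); move: IHM; rewrite n0M => IHM.
  apply: le_trans (lerD IHM (lexx _)) _; rewrite le_eqVlt; apply/orP; left.
  by apply/eqP; rewrite exprS; field; rewrite lt0r_neq0.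
rewrite addr0; move: IHM; rewrite leqNgt n0M subrr mul0r /= => IHM.
apply: le_trans IHM _; rewrite divr_ge0 ?(ltW rho'_gt0) // subr_ge0.
by case: ifP => [|_ //]; rewrite leq_eqVlt ltnNge n0M orbF => /eqP <-.
Qed.

Section OperatorSums.
Context {R : realType} {T : Type}.
Implicit Types (A : (T -> R) -> T -> R) (f : T -> R).

Definition opsum (w : R) n (A : nat -> (T -> R) -> T -> R) f x : R :=
  w * \sum_(i < n) A i f x.

Lemma posop_opsum w n (F : nat -> (T -> R) -> T -> R) : 0 <= w ->
  (forall i, positive_operator (F i)) -> positive_operator (opsum w n F).
Proof.
move=> w_ge0 posF; split => [l f g x|f f_ge0 x]; rewrite /opsum.
  under eq_bigr => i _ do rewrite (posop_linear (posF i)).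
  by rewrite big_split /= -big_distrr /=; ring.
by rewrite mulr_ge0 // sumr_ge0 // => i _; exact: (posop_ge0 (posF i)).
Qed.

Lemma iter_telescope A f n x : positive_operator A ->
  \sum_(i < n) iter i A (fun y => f y - A f y) x = f x - iter n A f x.
Proof.
move=> posA; elim: n => [|n IHn]; first by rewrite big_ord0 subrr.
rewrite big_ord_recr /= IHn (posopB (posop_iter posA n)) -iterSr /=.
by rewrite addrA subrK.
Qed.

End OperatorSums.

Section Range.
Context {R : realType} {d N : nat}.
Local Notation E := (thick d N).
Implicit Types (A : (E -> R) -> E -> R).

Definition distance (x y : E) : R := `|position x - position y : 'rV[R]_d|.

(** Finite range is stated dually, by functions vanishing on a ball of the sup distance, because the
    operators come without an explicit kernel. *)
Definition has_range A (r : R) : Prop := forall f x,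
  (forall y, distance x y <= r -> f y = 0) -> A f x = 0.

Lemma distance_triangle x y z : distance x z <= distance x y + distance y z.
Proof. by rewrite /distance -[X in `|X|](subrKA (position y)) ler_normD. Qed.

Lemma distancexx x : distance x x = 0.
Proof. by rewrite /distance subrr normr0. Qed.

Lemma has_range_iter A r n : has_range A r -> has_range (iter n A) (n%:R * r).
Proof.
move=> rA; elim: n => [|n IHn] f x f0 /=.
  by apply: f0; rewrite distancexx mul0r.
apply: rA => y xy; apply: IHn => z yz; apply: f0.
apply: le_trans (distance_triangle x y z) _.
by rewrite -natr1 mulrDl mul1r addrC lerD.
Qed.

Lemma has_range_le A r r' : has_range A r -> r <= r' -> has_range A r'.
Proof. by move=> rA rr' f x f0; apply: rA => y /le_trans/(_ rr')/f0. Qed.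

Lemma has_range_opsum w n (A : nat -> (E -> R) -> E -> R) r :
  (forall i, (i < n)%N -> has_range (A i) r) -> has_range (opsum w n A) r.
Proof.
by move=> rA f x f0; rewrite /opsum big1 ?mulr0 // => i _; exact: rA.
Qed.

Lemma translation_invariant_opsum w n (A : nat -> (E -> R) -> E -> R) :
  (forall i, translation_invariant (A i)) -> translation_invariant (opsum w n A).
Proof.
by move=> trA e f x; rewrite /opsum; congr (_ * _); apply: eq_bigr => i _; exact: trA.
Qed.

Lemma position_shift (x a : E) : position (shift x a) = position x + position a :> 'rV[R]_d.
Proof. by rewrite /position map_mxD. Qed.

Lemma step_has_range S c : exists2 r : R, 0 <= r & has_range (step_op S c) r.
Proof.
exists (\sum_(a <- S) `|position a : 'rV[R]_d|) => [|f x f0].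
  by apply: sumr_ge0 => a _; exact: normr_ge0.
rewrite /step_op big_seq big1 // => a aS; rewrite f0 ?mulr0 //.
rewrite /distance position_shift opprD addNKr normrN.
by rewrite (big_rem a) //= lerDl sumr_ge0.
Qed.

End Range.

(** * Almost translation invariance of the Green function *)

Section RatioLimit.
Context {R : realType} {d N : nat}.
Local Notation E := (thick d N).
Context (S : seq E) (c : 'I_N -> E -> R).
Context (c_walk : irreducible_walk S c) (c_stoch : stochastic S c).
Local Notation P := (step_op S c).

(** The power 0 charges the jump 0, and sufficiently many powers together charge the jump [e] from
    every type, which a single power need not do because of periodicity. *)
Let average L : (E -> R) -> E -> R := opsum L.+1%:R^-1 L.+1 (fun i => iter i P).

Let posP := step_posop c_walk.

Let iter_cst n l x : iter n P (fun=> l) x = l.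
Proof.
rewrite (@posop_iter_eigen _ _ _ posP 1); first by rewrite expr1n mul1r.
by move=> y; rewrite step_cst // mul1r.
Qed.

Let average_posop L : positive_operator (average L).
Proof.
by apply: posop_opsum => [|i]; [rewrite invr_ge0 ler0n | exact: posop_iter].
Qed.

Let average_translate L : translation_invariant (average L).
Proof.
by apply: translation_invariant_opsum => i; apply: translation_invariant_iter;
  exact: step_translate.
Qed.

Let average1 L x : average L (fun=> 1) x = 1.
Proof.
rewrite /average /opsum; under eq_bigr => i _ do rewrite iter_cst.
by rewrite sumr_const card_ord mulVf ?pnatr_eq0.
Qed.

Let average_low (e : 'rV[int]_d) : exists L, exists2 al, 0 < al &
  forall f, (forall y, 0 <= f y) -> forall x,
    al * (f x + f (translate e x)) <= average L.+1 f x.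
Proof.
have [n n_gt0] := choice (fun k => walk_irreducible c_walk (0, k) (e, k)).
have [ka ka_gt0 ka_le] : exists2 ka, 0 < ka &
    forall k, ka <= iter (n k) P (delta (e, k)) (0, k).
  apply: finite_uniform => [k r r' ? _ /le_trans|k]; first by apply.
  by exists (iter (n k) P (delta (e, k)) (0, k)).
pose L := (\sum_k n k)%N; pose w : R := L.+2%:R^-1.
have w_gt0 : 0 < w by rewrite invr_gt0 ltr0n.
pose m := Num.min 1 ka.
have m_gt0 : 0 < m by rewrite lt_min ltr01.
have m_le1 : m <= 1 by rewrite ge_min lexx.
have m_le : m <= ka by rewrite ge_min lexx orbT.
(* [w] is the weight of one power, and halving [m] shares the same sum between the jumps 0 and [e].
   Averaging up to [L.+1] ensures that the power 1 occurs, on which the contraction in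
   [average_vanish] relies. *)
exists L, (w * (m / 2)) => [|f f_ge0 x]; first by rewrite mulr_gt0 // divr_gt0.
have term_ge0 i : 0 <= iter i P f x by apply: (posop_ge0 (posop_iter posP i)).
have sum_ge i : (i <= L)%N -> iter i P f x <= \sum_(j < L.+2) iter j P f x.
  move=> iL; rewrite (bigD1 (Ordinal (leqW iL : (i < L.+2)%N))) //= lerDl.
  by apply: sumr_ge0 => j _.
have nL : (n x.2 <= L)%N by rewrite /L (bigD1 x.2) //= leq_addr.
have low0 := sum_ge 0%N isT.
have low1 : ka * f (translate e x) <= \sum_(j < L.+2) iter j P f x.
  apply: le_trans (sum_ge _ nL).
  have := translation_invariant_iter (n x.2) (@step_translate _ _ _ S c) x.1 f (0, x.2).
  have -> : translate x.1 (0, x.2) = x by case: (x) => y k; rewrite /translate add0r.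
  move=> <-; apply: (@le_trans _ _ (iter (n x.2) P (delta (e, x.2)) (0, x.2) * f (translate e x))).
    by rewrite ler_wpM2r.
  rewrite mulrC -(posopZ (posop_iter posP _)).
  apply: (posop_le (posop_iter posP _)) => y; rewrite /delta.
  case: eqP => [->|_]; last by rewrite mulr0.
  by rewrite mulr1 /translate /= addrC.
have fx := f_ge0 x; have fe := f_ge0 (translate e x).
rewrite /average /opsum -mulrA ler_pM2l //; rewrite /= in low0.
have : m * f (translate e x) <= ka * f (translate e x) by rewrite ler_wpM2r.
have : m * f x <= f x by rewrite ler_piMl.
by lra.
Qed.

(** All powers of the average fix [f], so the left side of [ratio_bound] does not depend on [n]; let
    [n] tend to infinity, then [ep] to 0. *)
Lemma bounded_harmonic_translate (f : E -> R) (e : 'rV[int]_d) :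
  (forall x, P f x = f x) -> (forall x, 0 <= f x <= 1) ->
  forall x, f (translate e x) = f x.
Proof.
move=> fP f01 x; have [L [al al_gt0 low]] := average_low e.
have avgf y : average L.+1 f y = 1 * f y.
  rewrite /average /opsum mul1r.
  have iterf i : iter i P f y = f y.
    rewrite (@posop_iter_eigen _ _ _ posP 1); first by rewrite expr1n mul1r.
    by move=> z; rewrite fP mul1r.
  under eq_bigr => i _ do rewrite iterf.
  by rewrite sumr_const card_ord -[f y *+ _]mulr_natl mulKf ?pnatr_eq0.
have iterf n y : iter n (average L.+1) f y = f y.
  by rewrite (posop_iter_eigen (average_posop L.+1) avgf) expr1n mul1r.
apply/eqP; rewrite -subr_eq0 -normr_le0; apply/ler_addgt0Pr => ep ep_gt0.
have [C [rho [_ rho_ge0 rho_lt1]]] := ratio_bound (average_posop L.+1)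
  (@average_translate L.+1) (@average1 L.+1) al_gt0 low ep_gt0.
move=> /(_ f f01) bound; apply: (le_of_geometric rho_ge0 rho_lt1 (C := C)) => n.
have := bound n x; rewrite !iterf add0r => /le_trans; apply.
by rewrite lerD2r ler_piMr //; [rewrite ltW | case/andP: (f01 x)].
Qed.

Lemma bounded_harmonic_cst (f : E -> R) :
  (forall x, P f x = f x) -> (forall x, 0 <= f x <= 1) -> forall x y, f x = f y.
Proof.
move=> fP f01; have f_type x : f x = f (0, x.2).
  have {1}-> : x = translate x.1 (0, x.2).
    by case: (x) => y k; rewrite /translate add0r.
  exact: bounded_harmonic_translate.
move=> x y; rewrite f_type [RHS]f_type.
apply: (type_harmonic_cst c_walk c_stoch (phi := fun k => f (0, k))) => k.
by rewrite -[RHS]fP /type_op /step_op; apply: eq_bigr => a _; rewrite [in RHS]f_type.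
Qed.

(** Domination by a strictly contracted [Phi] forces the iterates of [P] on [g] to vanish. This
    excludes adding a harmonic function to the Green function, and it survives Doob transforms. *)
Definition green_function (y : E) (g : E -> R) : Prop :=
  [/\ forall x, g x = delta y x + P g x, forall x, 0 <= g x &
      exists Phi rho, [/\ 0 <= rho, rho < 1, forall x, g x <= Phi x &
        forall x, P Phi x <= rho * Phi x] ].

Lemma green_superharmonic y g : green_function y g -> superharmonic P g.
Proof.
by move=> [gE g_ge0 _]; split => // x; rewrite [leRHS]gE lerDr delta_ge0.
Qed.

Lemma green_diag y g : green_function y g -> 1 <= g y.
Proof.
move=> [gE g_ge0 _]; rewrite gE /delta eqxx lerDl.
exact: (posop_ge0 (step_posop c_walk)).
Qed.

(** The average contracts [Phi] by the mean of the powers of [rho] up to [L.+1], which is below 1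
    thanks to the power 1. *)
Let average_vanish L (Phi g : E -> R) rho : 0 <= rho -> rho < 1 ->
  (forall y, 0 <= g y <= Phi y) -> (forall y, P Phi y <= rho * Phi y) ->
  exists rho', [/\ 0 <= rho', rho' < 1 &
    forall n x, 0 <= iter n (average L.+1) g x <= Phi x * rho' ^+ n].
Proof.
move=> rho_ge0 rho_lt1 g0Phi PPhi.
have Phi_ge0 y : 0 <= Phi y by case/andP: (g0Phi y) => /le_trans; apply.
pose rho' := L.+2%:R^-1 * \sum_(i < L.+2) rho ^+ i.
have n_gt0 : 0 < L.+2%:R :> R by rewrite ltr0n.
exists rho'; split => [||n x].
- by rewrite mulr_ge0 ?invr_ge0 // sumr_ge0 // => i _; rewrite exprn_ge0.
- rewrite /rho' mulrC ltr_pdivrMr // mul1r 2!big_ord_recl expr0 /=.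
  have -> : L.+2%:R = 1 + 1 + L%:R :> R by rewrite -addn2 natrD; lra.
  rewrite addrA ltr_leD //; first by rewrite ltrD2l expr1.
  apply: (@le_trans _ _ (\sum_(i < L) 1)); last by rewrite sumr_const card_ord.
  by apply: ler_sum => i _; rewrite exprn_ile1 // ltW.
- apply/andP; split.
    by apply: (posop_ge0 (posop_iter (average_posop _) n)) => y; case/andP: (g0Phi y).
  apply: (@le_trans _ _ (iter n (average L.+1) Phi x)).
    by apply: (posop_le (posop_iter (average_posop _) n)) => y; case/andP: (g0Phi y).
  rewrite mulrC; apply: (posop_iter_le_eigen (average_posop _)).
    by rewrite mulr_ge0 ?invr_ge0 // sumr_ge0 // => i _; rewrite exprn_ge0.
  move=> y; rewrite /average /opsum /rho' -mulrA ler_pM2l ?invr_gt0 // big_distrl /=.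
  by apply: ler_sum => i _; exact: (posop_iter_le_eigen posP).
Qed.

(** The Green function is expanded along the averaged walk [q]. By finite range the terms before
    [n0] vanish at both points; [ratio_bound] controls the others, which sum to at most [ep * g x]
    and a geometric tail. *)
Lemma green_ratio (e : 'rV[int]_d) (ep : R) : 0 < ep ->
  exists C rho r : R, [/\ 0 <= C, 0 <= rho, rho < 1, 0 <= r &
    forall y g, green_function y g -> forall x n0,
      n0%:R * r < distance x y -> n0%:R * r < distance (translate e x) y ->
      `|g (translate e x) - g x| <= ep * g x + C * rho ^+ n0].
Proof.
move=> ep_gt0; have [L [al al_gt0 low]] := average_low e.
have [C [rho [C_ge0 rho_ge0 rho_lt1 bound]]] := ratio_bound (average_posop L.+1)
  (@average_translate L.+1) (@average1 L.+1) al_gt0 low ep_gt0.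
have [r0 r0_ge0 range_P] := @step_has_range R d N S c.
pose q := average L.+1; pose B : R := L.+2%:R; pose r := B * r0.
(* Telescoping gives [J (f - P f) = f - q f]; hence [J (delta y)] is the source of which [g] is the
   Green potential for [q]. *)
pose J : (E -> R) -> E -> R := opsum B^-1 L.+2 (fun i => opsum 1 i (fun j => iter j P)).
have B_gt0 : 0 < B by rewrite ltr0n.
have posJ : positive_operator J.
  apply: posop_opsum => [|i]; first by rewrite invr_ge0 ltW.
  by apply: posop_opsum => // j; exact: posop_iter.
have range_iter i : (i <= L.+2)%N -> has_range (iter i P) r.
  move=> iL; have iB : i%:R * r0 <= r by rewrite ler_wpM2r // ler_nat.
  exact: has_range_le (has_range_iter (n := i) range_P) iB.
have range_q : has_range q r.
  by apply: has_range_opsum => i /ltnW; exact: range_iter.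
have range_J : has_range J r.
  apply: has_range_opsum => i iL; apply: has_range_opsum => j ji.
  by apply: range_iter; apply: ltnW; exact: ltn_trans ji iL.
exists (B * C / (1 - rho)), rho, r; split => // [||y g gy x n0 n0x n0u].
- by rewrite divr_ge0 ?mulr_ge0 ?(ltW B_gt0) // subr_ge0 ltW.
- by rewrite mulr_ge0 // ltW.
have [gE g_ge0 [Phi [rh [rh_ge0 rh_lt1 gPhi PPhi]]]] := gy.
set u := translate e x in n0u *.
(* [B] bounds [F], so [f] takes values in the unit interval as [ratio_bound] requires. *)
pose F := J (delta y); pose f z := B^-1 * F z.
have FE : F = (fun z => g z - q g z).
  have dE : delta y = (fun z => g z - P g z).
    by apply: funext => z; rewrite [X in X - _]gE addrK.
  apply: funext => z; rewrite /F dE.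
  rewrite /J /q /average /opsum; under eq_bigr => i _ do
    rewrite mul1r (iter_telescope _ _ _ posP).
  rewrite sumrB mulrBr sumr_const card_ord -[g z *+ _]mulr_natl.
  by rewrite mulKf // pnatr_eq0.
have F_ge0 z : 0 <= F z by apply: (posop_ge0 posJ) => w; exact: delta_ge0.
have F_le z : F z <= B.
  apply: (@le_trans _ _ (J (fun=> 1) z)).
    by apply: (posop_le posJ) => w; exact: delta_le1.
  rewrite /J /opsum mulrC ler_pdivrMr //.
  apply: (@le_trans _ _ (\sum_(i < L.+2) B)).
    apply: ler_sum => i _; under eq_bigr => j _ do rewrite iter_cst.
    by rewrite mul1r sumr_const card_ord ler_nat ltnW.
  by rewrite sumr_const card_ord -[B *+ _]mulr_natl.
have f01 z : 0 <= f z <= 1.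
  rewrite mulr_ge0 ?invr_ge0 ?(ltW B_gt0) //=.
  by rewrite /f mulrC ler_pdivrMr // mul1r.
have iterF n z : iter n q F z = B * iter n q f z.
  rewrite -(posopZ (posop_iter (average_posop _) n)).
  suff -> : F = (fun y => B * f y) by [].
  by apply: funext => w; rewrite /f mulVKf // lt0r_neq0.
(* The [n] applications of [q] have range [n%:R * r], and [J] inside [F] adds one more [r]. *)
have iter_supp n z : n.+1%:R * r < distance z y -> iter n q F z = 0.
  move=> nz; apply: (has_range_iter (n := n) range_q) => w zw.
  apply: range_J => w' ww'; rewrite /delta; case: eqP => // w'y.
  have wy : distance w y <= r by rewrite -w'y.
  suff : distance z y <= n.+1%:R * r by rewrite leNgt nz.
  apply: le_trans (distance_triangle z w y) _.
  by rewrite -natr1 mulrDl mul1r lerD.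
have term n : `|iter n q F u - iter n q F x| <=
    ep * iter n.+1 q F x + B * C * (if (n0 <= n)%N then rho ^+ n else 0).
  case: leqP => [n0n|nn0].
    rewrite !iterF -mulrBr normrM (gtr0_norm B_gt0) mulrCA -mulrA -mulrDr.
    by rewrite ler_pM2l //; exact: bound.
  have small z : n0%:R * r < distance z y -> n.+1%:R * r < distance z y.
    by apply: le_lt_trans; rewrite ler_wpM2r ?ler_nat // mulr_ge0 // ltW.
  rewrite (iter_supp n u) ?small // (iter_supp n x) ?small // subrr normr0 mulr0 addr0 mulr_ge0 ?(ltW ep_gt0) //.
  exact: (posop_ge0 (posop_iter (average_posop _) _)).
have g0Phi z : 0 <= g z <= Phi z by rewrite g_ge0 gPhi.
have [rv [rv_ge0 rv_lt1 vanish]] := average_vanish L rh_ge0 rh_lt1 g0Phi PPhi.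
(* The expansion is stopped at [M]; the remainders at [u] and [x] decay like [rv ^+ M]. *)
apply: (le_of_geometric rv_ge0 rv_lt1 (C := Phi u + Phi x)) => M.
have sum_tele z : \sum_(n < M) iter n q F z = g z - iter M q g z.
  by rewrite FE (iter_telescope _ _ _ (average_posop L.+1)).
have sum_diff : g u - g x = \sum_(n < M) (iter n q F u - iter n q F x)
    + iter M q g u - iter M q g x.
  by rewrite sumrB !sum_tele; ring.
have sum_shift : \sum_(n < M) iter n.+1 q F x <= g x.
  have : \sum_(n < M.+1) iter n q F x = g x - iter M.+1 q g x.
    by rewrite FE (iter_telescope _ _ _ (average_posop L.+1)).
  rewrite big_ord_recl /= => sumE.
  have := F_ge0 x; have /andP[] := vanish M.+1 x.
  rewrite -/q /= in sumE *; lra.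
have tail := geometric_tail_le n0 M rho_ge0 rho_lt1.
have sum_le : `|\sum_(n < M) (iter n q F u - iter n q F x)| <=
    ep * g x + B * C / (1 - rho) * rho ^+ n0.
  apply: le_trans (ler_norm_sum _ _ _) _.
  apply: (@le_trans _ _ (\sum_(n < M) (ep * iter n.+1 q F x +
      B * C * (if (n0 <= n)%N then rho ^+ n else 0)))).
    by apply: ler_sum => n _; exact: term.
  rewrite big_split /= -mulr_sumr -[X in _ + X]mulr_sumr lerD //.
    by rewrite ler_wpM2l // ltW.
  rewrite [leRHS]mulrAC -[leRHS]mulrA ler_wpM2l //.
  by rewrite mulr_ge0 // ltW.
have /andP[vu_ge0 vu_le] := vanish M u; have /andP[vx_ge0 vx_le] := vanish M x.
rewrite sum_diff -addrA; apply: le_trans (ler_normD _ _) _.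
rewrite lerD //; apply: le_trans (ler_normB _ _) _.
by rewrite !ger0_norm // mulrDl lerD.
Qed.

End RatioLimit.

(** * Euclidean product and norm, compared with the sup norm *)

Section Vectors.
Context {R : realType} {d : nat}.
Implicit Types (u v w : 'rV[R]_d).

Definition dotp u v : R := \sum_i u 0 i * v 0 i.

Lemma dotpC u v : dotp u v = dotp v u.
Proof. by apply: eq_bigr => i _; rewrite mulrC. Qed.

Lemma dotpDr u v w : dotp u (v + w) = dotp u v + dotp u w.
Proof. by rewrite /dotp -big_split; apply: eq_bigr => i _; rewrite mxE mulrDr. Qed.

Lemma dotpZr u l v : dotp u (l *: v) = l * dotp u v.
Proof. by rewrite /dotp big_distrr; apply: eq_bigr => i _; rewrite mxE mulrCA. Qed.

Lemma dotpNr u v : dotp u (- v) = - dotp u v.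
Proof. by rewrite -scaleN1r dotpZr mulN1r. Qed.

Lemma dotpBr u v w : dotp u (v - w) = dotp u v - dotp u w.
Proof. by rewrite dotpDr dotpNr. Qed.

Lemma dotp0r u : dotp u 0 = 0.
Proof. by rewrite -(scale0r 0) dotpZr mul0r. Qed.

Lemma dotpDl u v w : dotp (u + v) w = dotp u w + dotp v w.
Proof. by rewrite dotpC dotpDr !(dotpC w). Qed.

Lemma dotpZl u l v : dotp (l *: u) v = l * dotp u v.
Proof. by rewrite dotpC dotpZr dotpC. Qed.

Lemma dotp_sumr u (I : Type) (r : seq I) (F : I -> 'rV[R]_d) :
  dotp u (\sum_(i <- r) F i) = \sum_(i <- r) dotp u (F i).
Proof. exact: (big_morph _ (dotpDr u) (dotp0r u)). Qed.

Lemma dotp_delta i v : dotp (delta_mx 0 i) v = v 0 i.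
Proof.
rewrite /dotp (bigD1 i) //= mxE !eqxx mul1r big1 ?addr0 // => j /negbTE ji.
by rewrite mxE ji andbF mul0r.
Qed.

Lemma dotpp_ge0 u : 0 <= dotp u u.
Proof. by apply: sumr_ge0 => i _; rewrite -expr2 sqr_ge0. Qed.

Lemma dotpp_eq0 u : dotp u u = 0 -> u = 0.
Proof.
move=> /eqP; rewrite psumr_eq0 => [/allP u0|i _]; last by rewrite -expr2 sqr_ge0.
apply/rowP => i; have := u0 i (mem_index_enum _).
by rewrite -expr2 sqrf_eq0 mxE => /eqP.
Qed.

Lemma enormE u : enorm u = Num.sqrt (dotp u u).
Proof. by congr Num.sqrt; apply: eq_bigr => i _; rewrite expr2. Qed.

Lemma enorm_ge0 u : 0 <= enorm u. Proof. exact: sqrtr_ge0. Qed.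

Lemma sqr_enorm u : enorm u ^+ 2 = dotp u u.
Proof. by rewrite enormE sqr_sqrtr // dotpp_ge0. Qed.

Lemma enormZ l u : enorm (l *: u) = `|l| * enorm u.
Proof.
rewrite !enormE dotpZr dotpZl mulrA -expr2 sqrtrM ?sqr_ge0 //.
by rewrite sqrtr_sqr.
Qed.

Lemma enorm_eq0 u : (enorm u == 0) = (u == 0).
Proof.
apply/eqP/eqP => [u0|->]; first by apply: dotpp_eq0; rewrite -sqr_enorm u0 expr0n.
by rewrite enormE dotp0r sqrtr0.
Qed.

Lemma norm_coord_le u i : `|u 0 i| <= `|u|.
Proof.
by rewrite [leRHS]mx_normrE; apply: (le_bigmax 0 (fun ij => `|u ij.1 ij.2|) (0, i)).
Qed.

Lemma norm_rV_le u l : 0 <= l -> (forall i, `|u 0 i| <= l) -> `|u| <= l.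
Proof.
move=> l_ge0 ul; rewrite [leLHS]mx_normrE; apply: bigmax_le => // -[i j] _ /=.
by rewrite (ord1 i).
Qed.

Lemma norm_le_enorm u : `|u| <= enorm u.
Proof.
apply: norm_rV_le => [|i]; first exact: enorm_ge0.
rewrite enormE -sqrtr_sqr ler_wsqrtr // /dotp (bigD1 i) //= -expr2 lerDl.
by apply: sumr_ge0 => j _; rewrite -expr2 sqr_ge0.
Qed.

Lemma enorm_le_norm u : enorm u <= d%:R * `|u|.
Proof.
have dn_ge0 : 0 <= d%:R * `|u| by rewrite mulr_ge0.
rewrite -(ler_pXn2r (n := 2)) ?nnegrE ?enorm_ge0 // sqr_enorm exprMn.
apply: (@le_trans _ _ (\sum_(i < d) `|u| ^+ 2)).
  apply: ler_sum => i _; rewrite -expr2 -[leLHS]real_normK ?num_real //.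
  by rewrite lerXn2r ?nnegrE // norm_coord_le.
rewrite sumr_const card_ord -[_ *+ d]mulr_natl ler_wpM2r ?sqr_ge0 //.
by rewrite -natrX ler_nat; case: (d) => // n; rewrite leq_pmulr.
Qed.

End Vectors.

(** * Deviations from the mean velocity *)

Section Deviation.
Context {R : realType} {d N : nat}.
Local Notation E := (thick d N).
Context (S : seq E) (c : 'I_N -> E -> R) (c_walk : irreducible_walk S c).
Local Notation P := (step_op S c).

Let posP := step_posop c_walk.

(** Every coordinate can move one unit towards [y] at each step, so a sup distance [n] needs [n]
    steps; the extra factor pays for a change of type on the spot. *)
Lemma harnack_chain : exists2 ka, 0 < ka & ka <= 1 /\
  forall f, superharmonic P f -> forall x y n, distance x y <= n%:R :> R ->
    ka ^+ n.+1 * f y <= f x.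
Proof.
(* Pairs of booleans encode the vectors with entries -1, 0, 1 by a finite type, as [finite_uniform]
   requires. *)
pose sgn (s : {ffun 'I_d -> bool * bool}) : 'rV[int]_d :=
  \row_i ((s i).1%:R - (s i).2%:R).
have [ka ka_gt0 ka_le] : exists2 ka, 0 < ka & forall s : {ffun 'I_d -> bool * bool},
    forall f, superharmonic P f -> forall (x : 'rV[int]_d) k j,
      ka * f (x + sgn s, j) <= f (x, k).
  apply: finite_uniform => [s r r' Qr r'_gt0 r'_le f fP x k j|s].
    by apply: le_trans (Qr f fP x k j); rewrite ler_wpM2r //; case: fP.
  exact: harnack_shift.
exists (Num.min 1 ka); first by rewrite lt_min ltr01.
split => [|f fP x y n xy]; first by rewrite ge_min lexx.
have [f_ge0 _] := fP; set m := Num.min 1 ka.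
have m_gt0 : 0 < m by rewrite lt_min ltr01.
have step s z k j : m * f (z + sgn s, j) <= f (z, k).
  by apply: le_trans (ka_le s f fP z k j); rewrite ler_wpM2r // ge_min lexx orbT.
have {xy} : forall i, `|y.1 0 i - x.1 0 i|%R <= n%:Z.
  move=> i; rewrite -(ler_int R) intr_norm rmorphB /=.
  apply: le_trans xy; rewrite /distance -normrN opprB.
  by apply: le_trans (norm_coord_le _ i); rewrite !mxE.
elim: n x => [|n IHn] [x k] /= xy.
  have {}xy : y = (x + sgn [ffun=> (false, false)], y.2).
    case: y xy => y j /= xy; congr (_, _); apply/rowP => i; rewrite !mxE ffunE subrr addr0.
    by apply/eqP; rewrite -subr_eq0 -normr_le0.
  by rewrite xy expr1; exact: step.
pose s := [ffun i => (0 < y.1 0 i - x 0 i, y.1 0 i - x 0 i < 0)].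
rewrite exprS -mulrA; apply: le_trans (step s x k y.2).
rewrite ler_pM2l //; apply: IHn => i; have := xy i; rewrite /= !mxE !ffunE /=.
set D := y.1 0 i - x 0 i; rewrite opprD addrA -/D.
by case: (ltgtP 0 D) => D0 /=; lia.
Qed.

Context (c_stoch : stochastic S c) (v : 'rV[R]_d) (G : 'I_N -> 'rV[R]_d).
Context (vG : mean_velocity S c v G).

(** The correction [G] gives the exponent the mean increment [t * dotp w v] from every type. *)
Definition exp_test (w : 'rV[R]_d) (t : R) (x : E) : R :=
  expR (t * dotp w (position x + G x.2)).

(** Second-order expansion of the exponential; [B] bounds all one-step increments of the corrected
    position along [w]. *)
Lemma exp_test_bound (w : 'rV[R]_d) : exists2 B : R, 0 <= B &
  forall t, 0 <= t -> t * B <= 1/2 -> forall x,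
    P (exp_test w t) x <= (1 + t * dotp w v + 2 * (t * B) ^+ 2) * exp_test w t x.
Proof.
pose s k a := dotp w (position a + G a.2 - G k).
pose B := \sum_k \sum_(a <- S) `|s k a|.
have B_ge k a : a \in S -> `|s k a| <= B.
  move=> aS; rewrite /B (bigD1 k) //= (big_rem a) //= -addrA lerDl.
  by rewrite addr_ge0 // sumr_ge0 // => j _; rewrite sumr_ge0.
exists B => [|t t_ge0 tB x]; first by apply: sumr_ge0 => k _; apply: sumr_ge0.
have -> : P (exp_test w t) x =
    (\sum_(a <- S) c x.2 a * expR (t * s x.2 a)) * exp_test w t x.
  rewrite big_distrl /=; apply: eq_bigr => a _; rewrite -mulrA; congr (_ * _).
  rewrite /exp_test -expRD position_shift -mulrDr -dotpDr; congr (expR (t * dotp w _)).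
  by rewrite /=; apply/rowP => i; rewrite !mxE; lra.
rewrite ler_wpM2r ?expR_ge0 //.
have -> : dotp w v = \sum_(a <- S) c x.2 a * s x.2 a.
  by rewrite -(vG x.2) dotp_sumr; apply: eq_bigr => a _; rewrite dotpZr.
have -> : 1 + t * (\sum_(a <- S) c x.2 a * s x.2 a) + 2 * (t * B) ^+ 2 =
    \sum_(a <- S) c x.2 a * (1 + t * s x.2 a + 2 * (t * B) ^+ 2).
  rewrite -{1}(c_stoch x.2) -[2 * _]mul1r -{1}(c_stoch x.2) big_distrl big_distrr.
  by rewrite -!big_split /=; apply: eq_bigr => a _; ring.
rewrite !big_seq; apply: ler_sum => a aS; rewrite ler_wpM2l ?(walk_ge0 c_walk) //.
have ts_le : `|t * s x.2 a| <= t * B by rewrite normrM ger0_norm // ler_wpM2l // B_ge.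
have := ler_expR_quad (le_trans (ler_norm _) (le_trans ts_le tB)) => /le_trans; apply.
rewrite lerD2l ler_pM2l // -real_normK ?num_real //.
by rewrite lerXn2r ?nnegrE // (le_trans (normr_ge0 _) ts_le).
Qed.

(** Chernoff bound: [f] is dominated by a multiple of [exp_test], whose growth falls short of the
    threshold by [t * eta / 2] per step. *)
Lemma deviation (w : 'rV[R]_d) (eta : R) (x0 : E) : 0 < eta ->
  exists C rho : R, [/\ 0 <= C, 0 <= rho, rho < 1 & forall m f,
    (forall z, f z <= 1) ->
    (forall z, 0 < f z -> m%:R * (dotp w v + eta) <= dotp w (position z)) ->
    iter m P f x0 <= C * rho ^+ m].
Proof.
move=> eta_gt0; have [B B_ge0 test] := exp_test_bound w.
(* The first bound gives [t * B <= 1/2]; the second keeps the quadratic error below half of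
   [t * eta]. *)
pose t := Num.min (1 / (2 * (B + 1))) (eta / (4 * (B ^+ 2 + 1))).
have B1_gt0 : 0 < B + 1 by rewrite ltr_wpDl.
have B2_gt0 : 0 < B ^+ 2 + 1 by rewrite ltr_wpDl // sqr_ge0.
have t_gt0 : 0 < t by rewrite lt_min !divr_gt0 ?mulr_gt0.
have tB : t * B <= 1/2.
  apply: (@le_trans _ _ (t * (B + 1))); first by rewrite ler_pM2l // lerDl.
  rewrite -ler_pdivlMr //; have -> : 1 / 2 / (B + 1) = 1 / (2 * (B + 1)).
    by field; rewrite lt0r_neq0.
  by rewrite ge_min lexx.
have tB2 : 2 * (t * B) ^+ 2 <= t * eta / 2.
  have : t * (4 * (B ^+ 2 + 1)) <= eta.
    by rewrite -ler_pdivlMr ?mulr_gt0 // ge_min lexx orbT.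
  by rewrite exprMn; nra.
pose b := \sum_k `|dotp w (G k)|.
pose rho := expR (- (t * eta / 2)).
exists (expR (t * b) * exp_test w t x0), rho; split.
- by rewrite mulr_ge0 ?expR_ge0.
- exact: expR_ge0.
- by rewrite expR_lt1 oppr_lt0 divr_gt0 // mulr_gt0.
move=> m f f_le1 f_far.
pose l := expR (t * b - t * (m%:R * (dotp w v + eta))).
have fle z : f z <= l * exp_test w t z.
  have [fz|fz] := lerP (f z) 0.
    by apply: le_trans fz _; rewrite mulr_ge0 ?expR_ge0.
  apply: le_trans (f_le1 z) _; rewrite -expRD -[leLHS]expR0 ler_expR dotpDr.
  have Gb : - b <= dotp w (G z.2).
    rewrite lerNl; apply: le_trans (ler_norm _) _; rewrite normrN /b (bigD1 z.2) //=.
    by rewrite lerDl sumr_ge0.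
  have tGb : t * - b <= t * dotp w (G z.2) by rewrite ler_pM2l.
  have : t * (m%:R * (dotp w v + eta)) <= t * dotp w (position z).
    by rewrite ler_pM2l // f_far.
  by move: tGb; rewrite mulrN !mulrDr; lra.
apply: le_trans (posop_le (posop_iter posP m) fle x0) _.
rewrite (posopZ (posop_iter posP m)).
have lam_ge0 : 0 <= expR (t * dotp w v + t * eta / 2) by exact: expR_ge0.
have testP x : P (exp_test w t) x <= expR (t * dotp w v + t * eta / 2) * exp_test w t x.
  apply: le_trans (test t (ltW t_gt0) tB x) _; rewrite ler_wpM2r ?expR_ge0 //.
  by apply: le_trans (expR_ge1Dx _); rewrite addrA lerD2l.
apply: (@le_trans _ _ (l * (expR (t * dotp w v + t * eta / 2) ^+ m * exp_test w t x0))).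
  by rewrite ler_wpM2l ?expR_ge0 //; exact: (posop_iter_le_eigen posP).
rewrite mulrA ?[_ * exp_test _ _ _ * _]mulrAC ler_wpM2r ?expR_ge0 //.
rewrite /l /rho -!expRM_natl -!expRD ler_expR.
by rewrite le_eqVlt; apply/orP; left; apply/eqP; field.
Qed.

Lemma concentration (eta : R) (x0 : E) : 0 < eta -> exists m0, forall m, (m0 <= m)%N ->
  1/2 <= iter m P (fun z => (`|position z - m%:R *: v| <= m%:R * eta)%R%:R) x0.
Proof.
move=> eta_gt0.
pose w (ib : 'I_d * bool) : 'rV[R]_d := (-1) ^+ ib.2 *: delta_mx 0 ib.1.
(* Union bound over the [2 * d] signed coordinate directions: their total mass stays below 1/2. The
   added 1 keeps the denominator positive. *)
pose del : R := (2 * (2 * d)%:R + 1)^-1.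
have del_gt0 : 0 < del by rewrite invr_gt0 ltr_wpDl // mulr_ge0.
pose far m ib (z : E) : R := (m%:R * (dotp (w ib) v + eta) <= dotp (w ib) (position z))%R%:R.
have [m0 m0P] : exists m0 : 'I_d * bool -> nat, forall ib m, (m0 ib <= m)%N ->
    iter m P (far m ib) x0 < del.
  suff /choice[m0 m0P] : forall ib : 'I_d * bool, exists m0, forall m, (m0 <= m)%N ->
      iter m P (far m ib) x0 < del by exists m0.
  move=> ib; have [C [rho [C_ge0 rho_ge0 rho_lt1 dev]]] := deviation (w ib) x0 eta_gt0.
  have [m0 m0P] := geometric_eventually_lt C rho_ge0 rho_lt1 del_gt0.
  exists m0 => m /m0P; apply: le_lt_trans; apply: dev => z; first by rewrite /far lern1 leq_b1.
  by rewrite /far ltr0n lt0b.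
exists (\sum_ib m0 ib)%N => m m0m.
set near := fun z : E => _.
have cover z : 1 <= near z + \sum_ib far m ib z.
  rewrite /near; have [|zfar] := lerP `|position z - m%:R *: v| (m%:R * eta).
    by rewrite lerDl sumr_ge0 // => ib _; exact: ler0n.
  rewrite add0r; suff [ib ibz] : exists ib, far m ib z = 1.
    by rewrite (bigD1 ib) //= ibz lerDl sumr_ge0 // => ? _; exact: ler0n.
  have [i zi] : exists i, m%:R * eta < `|(position z - m%:R *: v) 0 i|.
    apply: contrapT => zn; move: zfar; rewrite ltNge => /negP; apply.
    apply: norm_rV_le => [|i]; first by rewrite mulr_ge0 // ltW.
    by rewrite leNgt; apply/negP => zi; apply: zn; exists i.
  move: zi; have -> : (position z - m%:R *: v) 0 i = position z 0 i - m%:R * v 0 i.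
    by rewrite !mxE.
  move=> zi; exists (i, position z 0 i - m%:R * v 0 i < 0); rewrite /far /w /=.
  rewrite !dotpZl !dotp_delta; apply/eqP; rewrite pnatr_eq1 eqb1.
  have [D0|D0] := boolP (position z 0 i - m%:R * v 0 i < 0).
    by move: zi; rewrite ltr0_norm // expr1; lra.
  by move: zi; rewrite -leNgt in D0; rewrite ger0_norm // expr0; lra.
have := posop_le (posop_iter posP m) cover x0.
rewrite (posopD (posop_iter posP m)) (posop_sum (posop_iter posP m)).
have -> : iter m P (fun=> 1) x0 = 1.
  rewrite (@posop_iter_eigen _ _ _ posP 1); first by rewrite expr1n mul1r.
  by move=> y; rewrite step_cst // mul1r.
suff : \sum_ib iter m P (far m ib) x0 <= 1/2 by lra.
apply: (@le_trans _ _ (\sum_(ib : 'I_d * bool) del)).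
  apply: ler_sum => ib _; apply: ltW; apply: m0P; apply: leq_trans m0m.
  by rewrite (bigD1 ib) //= leq_addr.
rewrite sumr_const card_prod card_ord card_bool -[_ *+ _]mulr_natl mulnC.
rewrite ler_pdivrMr; last by rewrite ltr_wpDl // mulr_ge0.
by lra.
Qed.

End Deviation.

Section DirectionFilter.
Context {R : realType} {d N : nat}.
Local Notation E := (thick d N).

(* The trace on the lattice of the neighbourhoods of theta in [cat0]. *)
Definition dir_filter (theta : 'rV[R]_d) : set_system E := [set A | exists V (r : R),
  nbhs theta V /\ forall a : E, r < enorm (position a : 'rV[R]_d) ->
    V (direction a) -> A a].

Global Instance dir_filter_filter theta : Filter (dir_filter theta).
Proof.
split.
- by exists setT, 0; split => //; exact: filterT.
- move=> A B [V [r [nV rA]]] [W [s [nW sB]]].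
  exists (V `&` W), (Num.max r s); split; first exact: filterI.
  move=> a; rewrite gt_max => /andP[ra sa] [Va Wa].
  by split; [exact: rA | exact: sB].
- move=> A B AB [V [r [nV rA]]]; exists V, r; split => // a ra Va.
  by apply: AB; exact: rA.
Qed.

Lemma dir_filter_far theta (r : R) :
  \forall y \near dir_filter theta, r < enorm (position y : 'rV[R]_d).
Proof. by exists setT, r; split => //; exact: filterT. Qed.

Lemma dir_filter_near theta (ep : R) : 0 < ep ->
  \forall y \near dir_filter theta, `|direction y - theta| < ep.
Proof.
move=> ep_gt0; exists (ball theta ep), 0; split; first exact: nbhsx_ballx.
by move=> a _; rewrite -ball_normE /ball_ /= distrC.
Qed.

End DirectionFilter.

(** * The Green function along the velocity *)

Section GreenAsymptotics.
Context {R : realType} {d N : nat}.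
Local Notation E := (thick d N).
Context (S : seq E) (c : 'I_N -> E -> R).
Context (c_walk : irreducible_walk S c) (c_stoch : stochastic S c).
Context (theta : 'rV[R]_d) (sp : R) (G : 'I_N -> 'rV[R]_d).
Context (theta1 : enorm theta = 1) (sp_gt0 : 0 < sp)
  (vG : mean_velocity S c (sp *: theta) G).
Context (gr : E -> E -> R) (gr_green : forall y, green_function S c y (gr y)).
Local Notation P := (step_op S c).
Local Notation size y := (enorm (position y : 'rV[R]_d)).

(** With probability at least 1/2 the walk from [x0] is, at a suitable time, within a small multiple
    of [size y] of [y]. There the Green function is bounded below by [harnack_chain] and
    [green_diag]. *)
Lemma green_lower (eta : R) (x0 : E) : 0 < eta ->
  \forall y \near dir_filter theta, expR (- (eta * size y)) <= gr y x0.
Proof.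
move=> eta_gt0; have [ka ka_gt0 [ka_le1 chain]] := harnack_chain c_walk.
pose A := - ln ka.
have A_ge0 : 0 <= A by rewrite oppr_ge0 ln_le0.
have kaE : ka = expR (- A) by rewrite opprK lnK.
(* A Harnack chain of length about [2 * e0 * size y] then costs at most [eta / 2 * size y] in the
   exponent; the other half absorbs the constants. *)
pose e0 := eta / (4 * (A + 1)).
have A1_gt0 : 0 < A + 1 by rewrite ltr_wpDl.
have e0_gt0 : 0 < e0 by rewrite divr_gt0 // mulr_gt0.
have Ae0 : A * e0 * 4 <= eta.
  have -> : eta = (A + 1) * e0 * 4 by rewrite /e0; field; rewrite lt0r_neq0.
  by rewrite ler_pM2r // ler_pM2r // lerDl.
have [m0 conc] := concentration c_walk c_stoch vG x0 (mulr_gt0 e0_gt0 sp_gt0).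
pose C1 := sp * `|theta| + 1.
near=> y.
have Y_dir : `|direction y - theta| < e0 by near: y; exact: dir_filter_near.
have Y_m0 : m0%:R * sp < size y by near: y; exact: dir_filter_far.
have Y_big : (A * (C1 + 1) + 1) / (eta / 2) < size y by near: y; exact: dir_filter_far.
set Y := size y in Y_m0 Y_big *.
have Y_gt0 : 0 < Y by apply: le_lt_trans Y_m0; rewrite mulr_ge0 // ltW.
have posE : position y = Y *: direction y :> 'rV[R]_d.
  by rewrite /direction scalerA mulfV ?scale1r // lt0r_neq0.
have Ysp_ge0 : 0 <= Y / sp by rewrite divr_ge0 ?ltW.
(* At time [m] the mean travelled length [m%:R * sp] differs from [Y] by less than [sp]. *)
pose m := Num.truncn (Y / sp).
have /andP[m_le m_gt] := truncn_itv Ysp_ge0; rewrite -/m in m_le m_gt.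
have {}m_le : m%:R * sp <= Y by rewrite -ler_pdivlMr.
have {}m_gt : Y < m%:R * sp + sp by rewrite -{2}[sp]mul1r -mulrDl natr1 -ltr_pdivrMr.
have m0m : (m0 <= m)%N by rewrite truncn_ge_nat // ler_pdivlMr // ltW.
pose D := 2 * e0 * Y + sp * `|theta|.
have D_ge0 : 0 <= D.
  have e0Y : 0 < e0 * Y by rewrite mulr_gt0.
  have spt : 0 <= sp * `|theta| by rewrite mulr_ge0 // ltW.
  by rewrite /D; lra.
pose n := (Num.truncn D).+1.
have /andP[n_le /ltW n_gt] := truncn_itv D_ge0; rewrite -/n in n_gt.
have close z : `|position z - m%:R *: (sp *: theta)| <= m%:R * (e0 * sp) ->
    distance z y <= n%:R :> R.
  move=> zm; apply: le_trans n_gt; rewrite /distance.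
  rewrite -[position z - _](subrKA (m%:R *: (sp *: theta))).
  apply: le_trans (ler_normD _ _) _.
  have -> : m%:R *: (sp *: theta) - position y =
      (m%:R * sp - Y) *: theta + Y *: (theta - direction y).
    by rewrite posE scalerA scalerBl scalerBr addrA subrK.
  have h1 : `|(m%:R * sp - Y) *: theta| <= sp * `|theta|.
    rewrite normrZ ler_wpM2r // ler_norml; apply/andP; split; lra.
  have h2 : `|Y *: (theta - direction y)| <= Y * e0.
    by rewrite normrZ gtr0_norm // ler_pM2l // distrC ltW.
  have h3 : m%:R * (e0 * sp) <= Y * e0 by rewrite mulrCA mulrC ler_pM2r.
  have := ler_normD ((m%:R * sp - Y) *: theta) (Y *: (theta - direction y)).
  by rewrite /D; lra.
have gy_sup := green_superharmonic (gr_green y).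
have [g_ge0 _] := gy_sup.
have low z : ka ^+ n.+1 *
    (`|position z - m%:R *: (sp *: theta)| <= m%:R * (e0 * sp))%R%:R <= gr y z.
  have [zm|_] := boolP (`|position z - m%:R *: (sp *: theta)| <= m%:R * (e0 * sp)).
    have zy := close z zm; rewrite /= mulr1 -[ka ^+ _]mulr1.
    apply: le_trans (chain _ gy_sup _ _ _ zy); rewrite ler_pM2l ?exprn_gt0 //.
    exact: (green_diag c_walk (gr_green y)).
  by rewrite /= mulr0.
have := posop_iter_superharmonic (step_posop c_walk) (proj2 gy_sup) m x0.
apply: le_trans; apply: le_trans (posop_le (posop_iter (step_posop c_walk) m) low x0).
rewrite (posopZ (posop_iter (step_posop c_walk) m)).
apply: (@le_trans _ _ (ka ^+ n.+1 * (1/2))); last first.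
  by rewrite ler_pM2l ?exprn_gt0 // conc.
(* [expR (- 1)] undercuts 1/2, so that the whole bound becomes a single exponential. *)
apply: (@le_trans _ _ (ka ^+ n.+1 * expR (- 1))); last first.
  rewrite ler_pM2l ?exprn_gt0 // expRN div1r lef_pV2 ?posrE ?expR_gt0 //.
  by have := @expR_ge1Dx R 1; lra.
rewrite kaE -expRM_natl -expRD ler_expR.
move: Y_big; rewrite ltr_pdivrMr ?divr_gt0 // => Y_big.
have nle : n.+1%:R <= D + 2 :> R by rewrite /n -natr1 -natr1; lra.
have : A * n.+1%:R <= A * (D + 2) by rewrite ler_wpM2l.
have : A * e0 * 4 * Y <= eta * Y by rewrite ler_pM2r.
by rewrite /D; rewrite /C1 in Y_big; nra.
Unshelve. all: by end_near. Qed.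

(** The error term of [green_ratio] is exponentially small in [size y], whereas [green_lower] bounds
    the Green function below at any chosen exponential rate. *)
Lemma green_translate_near (e : 'rV[int]_d) (x x0 : E) (ep : R) : 0 < ep ->
  \forall y \near dir_filter theta,
    `|gr y (translate e x) - gr y x| <= ep * gr y x0.
Proof.
move=> ep_gt0; have [ka ka_gt0 ka_le] := harnack c_walk x0 x.
have ep'_gt0 : 0 < ep / 2 * ka by rewrite mulr_gt0 // divr_gt0.
have [C [rho [r [C_ge0 rho_ge0 rho_lt1 r_ge0 ratio]]]] :=
  green_ratio c_walk c_stoch e ep'_gt0.
have d_gt0 : 0 < d%:R :> R.
  rewrite ltr0n lt0n; apply/negP => /eqP d0; move: theta1.
  rewrite enormE /dotp big1 => [|i _]; last by have := ltn_ord i; rewrite {2}d0.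
  by rewrite sqrtr0; move/eqP; rewrite eq_sym oner_eq0.
have r1_gt0 : 0 < r + 1 by rewrite ltr_wpDl.
(* With [n0] about [size y / K], the [n0] steps of range [r] cannot reach [y]: the factor [d]
   compares the norms and the factor 2 leaves room for the positions of the two starting points. *)
pose K := d%:R * 2 * (r + 1).
have K_gt0 : 0 < K by rewrite !mulr_gt0.
pose be := 1 - rho; have be_gt0 : 0 < be by rewrite subr_gt0.
(* The error decays like [expR (- (2 * eta * size y))]: one half of the rate is compared with the
   Green function, the other absorbs [C]. *)
pose eta := be / (2 * K); have eta_gt0 : 0 < eta by rewrite divr_gt0 // mulr_gt0.
near=> y.
have lower : expR (- (eta * size y)) <= gr y x0 by near: y; exact: green_lower.
have Y_gt0 : 0 < size y by near: y; exact: dir_filter_far.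
have Y_x : 2 * d%:R * `|position x : 'rV[R]_d| < size y by near: y; exact: dir_filter_far.
have Y_e : 2 * d%:R * `|position (translate e x) : 'rV[R]_d| < size y.
  by near: y; exact: dir_filter_far.
have Y_big : C * expR be / (ep / 2 * eta) < size y by near: y; exact: dir_filter_far.
set Y := size y in lower Y_gt0 Y_x Y_e Y_big *.
have YK_ge0 : 0 <= Y / K by rewrite divr_ge0 ?ltW.
pose n0 := Num.truncn (Y / K).
have /andP[n_le /ltW n_gt] := truncn_itv YK_ge0; rewrite -/n0 -natr1 in n_le n_gt.
have far z : 2 * d%:R * `|position z : 'rV[R]_d| < Y -> n0%:R * r < distance z y.
  move=> zY; have Yy : Y <= d%:R * `|position y : 'rV[R]_d| by exact: enorm_le_norm.
  have tri : `|position y : 'rV[R]_d| <= distance z y + `|position z : 'rV[R]_d|.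
    rewrite -[X in `|X|](subrK (position z)); apply: le_trans (ler_normD _ _) _.
    by rewrite distrC.
  have : n0%:R * (d%:R * 2 * (r + 1)) <= Y by rewrite -ler_pdivlMr.
  have nr : n0%:R * r <= n0%:R * (r + 1) by rewrite ler_wpM2l // lerDl.
  move=> nY; apply: (le_lt_trans nr); rewrite -(ltr_pM2l d_gt0).
  have : d%:R * `|position y : 'rV[R]_d| <= d%:R * (distance z y + `|position z : 'rV[R]_d|).
    by rewrite ler_pM2l.
  by nra.
apply: le_trans (ratio y _ (gr_green y) x n0 (far _ Y_x) (far _ Y_e)) _.
have gy_sup := green_superharmonic (gr_green y).
have -> : ep * gr y x0 = ep / 2 * gr y x0 + ep / 2 * gr y x0 by field.
apply: lerD.
  by rewrite -mulrA ler_pM2l ?divr_gt0 //; exact: ka_le.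
apply: (@le_trans _ _ (ep / 2 * expR (- (eta * Y)))); last first.
  by rewrite ler_pM2l ?divr_gt0.
have rho_le : rho <= expR (- be) by have := expR_ge1Dx (- be); rewrite /be; lra.
have rhoX : rho ^+ n0 <= expR (be - be * (Y / K)).
  apply: (@le_trans _ _ (expR (- be) ^+ n0)).
    by rewrite lerXn2r ?nnegrE ?expR_ge0.
  rewrite -expRM_natl ler_expR.
  have : be * (Y / K) <= be * (n0%:R + 1) by rewrite ler_pM2l.
  by lra.
apply: (@le_trans _ _ (C * expR (be - be * (Y / K)))); first by rewrite ler_wpM2l.
have -> : be - be * (Y / K) = be + - (eta * Y) + - (eta * Y).
  by rewrite /eta; field; rewrite lt0r_neq0.
rewrite !(expRD _ (- (eta * Y))) !mulrA ler_pM2r ?expR_gt0 //.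
rewrite (expRN (eta * Y)) ler_pdivrMr ?expR_gt0 //.
have ee_gt0 : 0 < ep / 2 * eta by apply: mulr_gt0 => //; rewrite divr_gt0.
move: Y_big; rewrite ltr_pdivrMr // => /ltW/le_trans; apply.
rewrite mulrCA ler_pM2l ?divr_gt0 // mulrC.
by have := expR_ge1Dx (eta * Y); lra.
Unshelve. all: by end_near. Qed.

(** By approximate translation invariance, the Green function over [x0.1] is almost harmonic as a
    function of the type; [type_defect_inverse] makes it almost constant. *)
Lemma green_ratio_cvg (x x0 : E) :
  gr y x / gr y x0 @[y --> dir_filter theta] --> (1 : R).
Proof.
have [b bP] := type_defect_inverse c_walk c_stoch x0.2.
apply/cvgrPdist_le => ep ep_gt0.
pose B := 1 + \sum_j `|b x.2 j|.
have B_gt0 : 0 < B by rewrite ltr_pwDl // sumr_ge0.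
pose del := ep / B; have del_gt0 : 0 < del by rewrite divr_gt0.
have xE : translate (x.1 - x0.1) (x0.1, x.2) = x.
  by case: (x) => z k; rewrite /translate /= addrC subrK.
near=> y.
have shiftx : `|gr y x - gr y (x0.1, x.2)| <= del * gr y x0.
  by rewrite -{1}xE; near: y; exact: green_translate_near.
have step : forall a, a \in S ->
    `|gr y (translate a.1 (x0.1, a.2)) - gr y (x0.1, a.2)| <= del * gr y x0.
  near: y; elim: (S) => [|a s IHs]; first by apply: nearW.
  apply: filterS2 (green_translate_near a.1 (x0.1, a.2) x0 del_gt0) IHs => y ya ys a'.
  by rewrite inE => /predU1P[->|/ys].
have y_far : size x0 < size y by near: y; exact: dir_filter_far.
pose f k := gr y (x0.1, k); rewrite -/(f x.2) in shiftx.
have gy_sup := green_superharmonic (gr_green y).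
have g0_gt0 : 0 < gr y x0.
  apply: (superharmonic_gt0 c_walk gy_sup (y := y)).
  by apply: lt_le_trans (green_diag c_walk (gr_green y)).
have defect k : `|f k - type_op S c f k| <= del * gr y x0.
  have [gE _ _] := gr_green y; rewrite {1}/f gE /delta.
  (* [y] is farther from the origin than [x0], so the Green equation has no source term here. *)
  have -> : ((x0.1, k) == y :> E) = false.
    by apply/eqP => yE; move: y_far; rewrite -yE ltxx.
  rewrite add0r /step_op /type_op -sumrB.
  apply: le_trans (ler_norm_sum _ _ _) _.
  rewrite -[leRHS]mul1r -(c_stoch k) big_distrl /= !big_seq; apply: ler_sum => a aS.
  rewrite -mulrBr normrM ger0_norm ?(walk_ge0 c_walk) //.
  by rewrite ler_wpM2l ?(walk_ge0 c_walk) //; exact: step.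
have fx : `|f x.2 - f x0.2| <= (\sum_j `|b x.2 j|) * (del * gr y x0).
  rewrite bP; apply: le_trans (ler_norm_sum _ _ _) _.
  rewrite big_distrl; apply: ler_sum => j _.
  by rewrite normrM ler_wpM2l.
have -> : 1 = gr y x0 / gr y x0 by rewrite divff // lt0r_neq0.
rewrite -mulrBl normrM normfV (gtr0_norm g0_gt0) ler_pdivrMr //.
have -> : ep = del * B by rewrite /del divfK // lt0r_neq0.
have f0 : f x0.2 = gr y x0 by rewrite /f -surjective_pairing.
rewrite distrC -f0 -[gr y x](subrK (f x.2)) -addrA.
apply: le_trans (ler_normD _ _) _.
by rewrite /B; rewrite -f0 in shiftx fx *; lra.
Unshelve. all: by end_near. Qed.

End GreenAsymptotics.

Lemma continuous_bigsum {R : realType} {T : topologicalType} (I : Type) (s : seq I)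
    (F : I -> T -> R) : (forall i, continuous (F i)) ->
  continuous (fun x => \sum_(i <- s) F i x).
Proof.
move=> cF x; elim: s => [|i s IHs].
  have -> : (fun x => \sum_(j <- [::]) F j x) = (fun=> 0).
    by apply: funext => y; rewrite big_nil.
  exact: cvg_cst.
have -> : (fun x => \sum_(j <- i :: s) F j x) = (fun x => F i x + \sum_(j <- s) F j x).
  by apply: funext => y; rewrite big_cons.
by apply: cvgD => //; exact: cF.
Qed.

Lemma compact_norm_le {R : realType} (n : nat) (M : R) :
  compact [set u : 'rV[R]_n | `|u| <= M].
Proof.
apply: bounded_closed_compact.
  by exists M; split => [|M' MM' u /= /le_trans]; [exact: num_real | apply; exact: ltW].
apply: (preimage_closed (f := fun u : 'rV[R]_n => `|u|)) (@closed_le _ M).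
by move=> u _; exact: norm_continuous.
Qed.

(** * Exponential superharmonic functions *)

Section Exponents.
Context {R : realType} {d N : nat}.
Local Notation E := (thick d N).
Context (S : seq E) (c : 'I_N -> E -> R) (c_walk : irreducible_walk S c).
Local Notation P := (step_op S c).
Implicit Types (u w : 'rV[R]_d) (phi : 'I_N -> R).

Definition exp_fun u phi (x : E) : R := expR (dotp u (position x)) * phi x.2.

(** The nonnegative matrix indexed by [u], read off at the origin, where the exponential factor is
    1. *)
Definition tilt u phi k : R := P (exp_fun u phi) (0, k).

Lemma position0 k : position ((0, k) : E) = 0 :> 'rV[R]_d.
Proof. by apply/rowP => i; rewrite !mxE. Qed.

Lemma exp_fun0 u phi k : exp_fun u phi (0, k) = phi k.
Proof. by rewrite /exp_fun position0 dotp0r expR0 mul1r. Qed.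

Lemma exp_fun_shift u phi x a :
  exp_fun u phi (shift x a) = expR (dotp u (position x)) * exp_fun u phi a.
Proof. by rewrite /exp_fun position_shift dotpDr expRD mulrA. Qed.

Lemma exp_fun_gt0 u phi x : (forall k, 0 < phi k) -> 0 < exp_fun u phi x.
Proof. by move=> phi_gt0; rewrite mulr_gt0 // expR_gt0. Qed.

Lemma tiltE u phi k : tilt u phi k = \sum_(a <- S) c k a * exp_fun u phi a.
Proof.
by rewrite /tilt /step_op; apply: eq_bigr => a _; rewrite exp_fun_shift position0
  dotp0r expR0 mul1r.
Qed.

Lemma step_exp_fun u phi : P (exp_fun u phi) = exp_fun u (tilt u phi).
Proof.
apply: funext => x; rewrite [RHS]/exp_fun tiltE big_distrr /=.
by apply: eq_bigr => a _; rewrite exp_fun_shift mulrCA.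
Qed.

Lemma iter_exp_fun n u phi : iter n P (exp_fun u phi) = exp_fun u (iter n (tilt u) phi).
Proof. by elim: n => //= n ->; rewrite step_exp_fun. Qed.

Definition subexponent u phi : Prop :=
  (forall k, 0 < phi k) /\ (forall k, tilt u phi k <= phi k).

Lemma subexponent_superharmonic u phi : subexponent u phi ->
  superharmonic P (exp_fun u phi).
Proof.
move=> [phi_gt0 sub]; split => x; first by rewrite ltW // exp_fun_gt0.
by rewrite step_exp_fun /exp_fun ler_pM2l ?expR_gt0.
Qed.

Lemma tiltZ u l phi k : tilt u (fun j => l * phi j) k = l * tilt u phi k.
Proof.
rewrite /tilt -(posopZ (step_posop c_walk)); congr (P _ _).
by apply: funext => x; rewrite /exp_fun mulrCA.
Qed.

Lemma tilt_ge0 u phi k : (forall j, 0 <= phi j) -> 0 <= tilt u phi k.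
Proof.
move=> phi_ge0; apply: (posop_ge0 (step_posop c_walk)) => x.
by rewrite /exp_fun mulr_ge0 ?expR_ge0.
Qed.

(** Strictness at finitely many types leaves room for a common factor [expR s], and moving [u] by
    [t *: w] multiplies each jump by no more than that. *)
Lemma subexponent_perturb u w phi : (forall k, 0 < phi k) ->
  (forall k, tilt u phi k < phi k) -> exists2 t : R, 0 < t & subexponent (u + t *: w) phi.
Proof.
move=> phi_gt0 strict.
have [s s_gt0 sP] : exists2 s : R, 0 < s & forall k, expR s * tilt u phi k <= phi k.
  apply: finite_uniform => [k s s' sP s'_gt0 s's|k].
    by apply: le_trans sP; rewrite ler_wpM2r ?ler_expR // tilt_ge0 // => j; exact: ltW.
  have [tk|tk] := lerP (tilt u phi k) 0.
    by exists 1 => //; apply: le_trans (ltW (phi_gt0 k)); rewrite pmulr_rle0 ?expR_gt0.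
  exists (ln (phi k / tilt u phi k)).
    by rewrite ln_gt0 // ltr_pdivlMr // mul1r.
  by rewrite lnK ?posrE ?divr_gt0 // divfK // lt0r_neq0.
pose W := \sum_(a <- S) `|dotp w (position a)|.
have W_ge0 : 0 <= W by exact: sumr_ge0.
have W1_gt0 : 0 < W + 1 by rewrite ltr_wpDl.
exists (s / (W + 1)); first by rewrite divr_gt0.
split => // k; apply: le_trans (sP k); rewrite !tiltE big_distrr /= !big_seq.
apply: ler_sum => a aS; rewrite [leRHS]mulrCA ler_wpM2l ?(walk_ge0 c_walk) //.
rewrite /exp_fun mulrA ler_pM2r // -expRD ler_expR dotpDl dotpZl addrC lerD2r.
have wa : dotp w (position a) <= W + 1.
  apply: le_trans (ler_norm _) _; rewrite /W (big_rem a) //= -addrA lerDl.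
  by rewrite addr_ge0 // sumr_ge0.
by rewrite mulrAC ler_pdivrMr // ler_pM2l.
Qed.

Lemma tilt_continuous k :
  continuous (fun z : 'rV[R]_d * 'rV[R]_N => tilt z.1 (z.2 0) k).
Proof.
have -> : (fun z : 'rV[R]_d * 'rV[R]_N => tilt z.1 (z.2 0) k) = (fun z =>
    \sum_(a <- S) c k a * (expR (\sum_i z.1 0 i * (position a : 'rV[R]_d) 0 i) * z.2 0 a.2)).
  by apply: funext => z; rewrite tiltE.
apply: continuous_bigsum => a z; apply: cvgM; first exact: cvg_cst.
apply: cvgM; last first.
  apply: (continuous_comp (f := snd) (g := fun v : 'rV[R]_N => v 0 a.2)).
    exact: cvg_snd.
  exact: coord_continuous.
apply: (continuous_comp (g := expR)); last exact: continuous_expR.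
apply: continuous_bigsum => i z'; apply: cvgM; last exact: cvg_cst.
apply: (continuous_comp (f := fst) (g := fun v : 'rV[R]_d => v 0 i)).
  exact: cvg_fst.
exact: coord_continuous.
Qed.

(** Harnack between the origin and the signed unit vectors bounds the coordinates of [u]; Harnack
    between types bounds [phi]. *)
Lemma subexponent_bounds (k0 : 'I_N) : exists M : R, forall u phi,
  subexponent u phi -> phi k0 = 1 -> `|u| <= M /\ forall k, phi k <= M.
Proof.
have [ka ka_gt0 kaP] : exists2 ka, 0 < ka & forall ib : 'I_d * bool,
    forall f, superharmonic P f ->
      ka * f ((-1) ^+ ib.2 *: delta_mx 0 ib.1, k0) <= f (0, k0).
  apply: finite_uniform => [ib r r' Qr r'_gt0 r'_le f fP|ib]; last exact: harnack.
  by apply: le_trans (Qr f fP); rewrite ler_wpM2r //; case: fP.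
have [kb kb_gt0 kbP] : exists2 kb, 0 < kb & forall k,
    forall f, superharmonic P f -> kb * f (0, k) <= f (0, k0).
  apply: finite_uniform => [k r r' Qr r'_gt0 r'_le f fP|k]; last exact: harnack.
  by apply: le_trans (Qr f fP); rewrite ler_wpM2r //; case: fP.
exists (`|ln ka| + kb^-1) => u phi sub phi1.
have sup := subexponent_superharmonic sub.
split => [|k]; last first.
  apply: (@le_trans _ _ kb^-1); last by rewrite lerDr.
  have := kbP k _ sup; rewrite !exp_fun0 phi1.
  by rewrite mulrC -ler_pdivlMr // div1r.
apply: norm_rV_le => [|i]; first by rewrite addr_ge0 // invr_ge0 ltW.
apply: (@le_trans _ _ `|ln ka|); last by rewrite lerDl invr_ge0 ltW.
have bound (b : bool) : (-1) ^+ b * u 0 i <= `|ln ka|.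
  have := kaP (i, b) _ sup; rewrite exp_fun0 phi1 /exp_fun /= phi1 mulr1.
  have -> : dotp u (position ((-1) ^+ b *: delta_mx 0 i, k0)) = (-1) ^+ b * u 0 i.
    rewrite -(dotp_delta i u) dotpC -dotpZl; congr (dotp _ _).
    by apply/rowP => j; rewrite !mxE; case: b; rewrite ?expr0 ?expr1 ?mulN1r ?mul1r
      ?rmorphN /= ?eqxx; case: eqP.
  rewrite -[X in X * expR _]lnK // -expRD -expR0 ler_expR => h.
  by have := ler_norm (- ln ka); rewrite normrN; lra.
rewrite ler_norml; apply/andP; split.
  by have := bound true; rewrite expr1 mulN1r; lra.
by have := bound false; rewrite expr0 mul1r.
Qed.

Lemma subexponent_max (k0 : 'I_N) (theta : 'rV[R]_d) u0 phi0 : subexponent u0 phi0 ->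
  exists u phi, subexponent u phi /\ forall u' phi', subexponent u' phi' ->
    dotp u' theta <= dotp u theta.
Proof.
move=> sub0; have [M MP] := subexponent_bounds k0.
pose K := [set u : 'rV[R]_d | `|u| <= M] `*` [set v : 'rV[R]_N | `|v| <= M].
(* Positivity is relaxed to nonnegativity and the normalisation to an inequality, so that [C] is
   closed; [superharmonic_gt0] recovers positivity of the maximiser. *)
pose C := \bigcap_(k in [set: 'I_N])
  ([set z : 'rV[R]_d * 'rV[R]_N | 0 <= z.2 0 k] `&`
   [set z : 'rV[R]_d * 'rV[R]_N | tilt z.1 (z.2 0) k - z.2 0 k <= 0]) `&`
  [set z : 'rV[R]_d * 'rV[R]_N | 1 <= z.2 0 k0].
have snd_cont k : continuous (fun z : 'rV[R]_d * 'rV[R]_N => z.2 0 k).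
  move=> z; apply: (continuous_comp (f := snd) (g := fun v : 'rV[R]_N => v 0 k)).
    exact: cvg_snd.
  exact: coord_continuous.
have C_closed : closed C.
  apply: closedI; last first.
    by apply: (preimage_closed (f := fun z : 'rV[R]_d * 'rV[R]_N => z.2 0 k0)) (@closed_ge _ 1) => z _;
      exact: snd_cont.
  apply: closed_bigI => k _; apply: closedI.
    by apply: (preimage_closed (f := fun z : 'rV[R]_d * 'rV[R]_N => z.2 0 k)) (@closed_ge _ 0) => z _;
      exact: snd_cont.
  apply: (preimage_closed (f := fun z : 'rV[R]_d * 'rV[R]_N => tilt z.1 (z.2 0) k - z.2 0 k))
    (@closed_le _ 0) => z _.
  by apply: cvgB; [exact: tilt_continuous | exact: snd_cont].
have KC_compact : compact (K `&` C).
  by apply: compact_closedI => //; apply: compact_setX; exact: compact_norm_le.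
have KC_in u phi : subexponent u phi ->
    (K `&` C) (u, \row_k (phi k / phi k0)).
  move=> [phi_gt0 sub].
  have sub1 : subexponent u (fun k => phi k / phi k0).
    split => k; first by rewrite divr_gt0.
    under eq_fun do rewrite mulrC.
    by rewrite tiltZ mulrC ler_pM2r ?invr_gt0.
  have [uM phiM] := MP _ _ sub1 (divff (lt0r_neq0 (phi_gt0 k0))).
  have M_ge0 : 0 <= M := le_trans (normr_ge0 _) uM.
  have rowE : (\row_k (phi k / phi k0)) 0 = (fun k => phi k / phi k0).
    by apply: funext => k; rewrite mxE.
  split; split => //=.
  - apply: norm_rV_le => // k; rewrite mxE ger0_norm //.
    by rewrite ltW // divr_gt0.
  - move=> k _ /=; rewrite mxE rowE subr_le0; case: sub1 => sub1_gt0 sub1.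
    by split; [rewrite ltW | exact: sub1].
  - by rewrite mxE divff // lt0r_neq0.
have dot_cont : continuous (fun z : 'rV[R]_d * 'rV[R]_N => dotp z.1 theta).
  apply: continuous_bigsum => i z; apply: cvgM; last exact: cvg_cst.
  apply: (continuous_comp (f := fst) (g := fun v : 'rV[R]_d => v 0 i)).
    exact: cvg_fst.
  exact: coord_continuous.
have [|[u v] /set_mem[_ [vC v1]] uv_max] := compact_EVT_max _ KC_compact (continuous_subspaceT dot_cont).
  by exists (u0, \row_k (phi0 k / phi0 k0)); exact: KC_in.
have v_sub k : tilt u (v 0) k <= v 0 k by have [_ /=] := vC k I; rewrite subr_le0.
have v_sup : superharmonic P (exp_fun u (v 0)).
  split => x; first by have [/= v_ge0 _] := vC x.2 I; rewrite mulr_ge0 ?expR_ge0.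
  by rewrite step_exp_fun /exp_fun ler_pM2l ?expR_gt0.
have v_gt0 k : 0 < v 0 k.
  rewrite -(exp_fun0 u); apply: (superharmonic_gt0 c_walk v_sup (y := (0, k0))).
  by rewrite exp_fun0; exact: lt_le_trans v1.
exists u, (v 0); split => // u' phi' /KC_in/mem_set/uv_max.
by [].
Qed.

(* If the maximiser were strict at one type, irreducibility would make a
   subexponent strict at every type, leaving room to increase [dotp _ theta]. *)
Lemma subexponent_max_harmonic (theta : 'rV[R]_d) u phi : theta != 0 ->
  subexponent u phi ->
  (forall u' phi', subexponent u' phi' -> dotp u' theta <= dotp u theta) ->
  forall k, tilt u phi k = phi k.
Proof.
move=> theta_neq0 sub max; have [phi_gt0 phi_sub] := sub.
suff no_strict k1 : phi k1 <= tilt u phi k1.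
  by move=> k; apply/eqP; rewrite eq_le phi_sub no_strict.
rewrite leNgt; apply/negP => k1_lt.
have posP := step_posop c_walk.
pose h := exp_fun u phi.
have [n nP] := choice (fun k => walk_irreducible c_walk (0, k) (0, k1)).
pose m := (\sum_k n k).+1%N.
(* Each type [k] reaches the strict type [k1] in [n k < m] steps, so summing the first [m] iterates
   spreads strictness to every type. *)
pose phi' k := \sum_(i < m) iter i (tilt u) phi k.
have iter_gt0 i k : 0 <= iter i (tilt u) phi k.
  by elim: i k => [|i IHi] k /=; [exact: ltW | exact: tilt_ge0].
have phi'_gt0 k : 0 < phi' k.
  rewrite /phi' /m big_ord_recl ltr_pwDl //.
  by apply: sumr_ge0 => i _; exact: iter_gt0.
have h'E : exp_fun u phi' = (fun x => \sum_(i < m) iter i P h x).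
  apply: funext => x; rewrite /exp_fun /phi' big_distrr /=; apply: eq_bigr => i _.
  by rewrite /h iter_exp_fun.
have strict k : tilt u phi' k < phi' k.
  rewrite -subr_gt0 -(exp_fun0 u phi') /tilt h'E (posop_sum posP) -sumrB.
  have -> : \sum_(i < m) (iter i P h (0, k) - P (iter i P h) (0, k)) =
      \sum_(i < m) iter i P (fun y => h y - P h y) (0, k).
    by apply: eq_bigr => i _; rewrite (posopB (posop_iter posP i)) -iterSr.
  have h_sup := subexponent_superharmonic sub.
  have r_ge0 y : 0 <= h y - P h y by rewrite subr_ge0; case: h_sup.
  have nk : (n k < m)%N by rewrite ltnS (bigD1 k) //= leq_addr.
  rewrite (bigD1 (Ordinal nk)) //= ltr_pwDl //; last first.
    by apply: sumr_ge0 => i _; exact: (posop_ge0 (posop_iter posP i)).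
  apply: (@lt_le_trans _ _ ((phi k1 - tilt u phi k1) * iter (n k) P (delta (0, k1)) (0, k))).
    by rewrite mulr_gt0 // subr_gt0.
  rewrite -(posopZ (posop_iter posP _)); apply: (posop_le (posop_iter posP _)) => y.
  rewrite /delta; case: eqP => [->|_]; last by rewrite mulr0.
  by rewrite mulr1 /h exp_fun0.
(* Perturbing along [theta] itself raises the maximised quantity by [t * dotp theta theta]. *)
have [t t_gt0 /max] := subexponent_perturb theta phi'_gt0 strict.
rewrite dotpDl dotpZl gerDl pmulr_rle0 // => theta_le0.
move: theta_neq0; rewrite -(inj_eq (@addrI _ 0)) ?addr0 ?add0r => /eqP; apply.
by apply: dotpp_eq0; apply/eqP; rewrite eq_le theta_le0 dotpp_ge0.
Qed.

End Exponents.

(** * Doob transforms *)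

Section Twist.
Context {R : realType} {d N : nat}.
Local Notation E := (thick d N).
Context (S : seq E) (c : 'I_N -> E -> R) (c_walk : irreducible_walk S c).
Context (u : 'rV[R]_d) (phi : 'I_N -> R) (phi_gt0 : forall k, 0 < phi k).
Local Notation P := (step_op S c).
Local Notation h := (exp_fun u phi).

(* Doob transform of the chain by the function h. *)
Definition twist k (a : E) : R := c k a * h a / phi k.

Let h_gt0 x : 0 < h x. Proof. exact: exp_fun_gt0. Qed.

Let h_neq0 x : h x != 0. Proof. by rewrite lt0r_neq0. Qed.

Lemma step_twist f x : step_op S twist f x = (h x)^-1 * P (fun y => h y * f y) x.
Proof.
rewrite /step_op big_distrr; apply: eq_bigr => a _ /=.
rewrite exp_fun_shift /twist /exp_fun; field.
by rewrite !lt0r_neq0 ?expR_gt0.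
Qed.

Lemma iter_step_twist n f x :
  iter n (step_op S twist) f x = (h x)^-1 * iter n P (fun y => h y * f y) x.
Proof.
elim: n x => [|n IHn] x /=; first by rewrite mulKf.
rewrite (funext IHn) step_twist; congr (_ * P _ _).
by apply: funext => y; rewrite mulVKf.
Qed.

Lemma twist_walk : irreducible_walk S twist.
Proof.
split => [k a|x y].
  by rewrite /twist !mulr_ge0 ?(walk_ge0 c_walk) ?invr_ge0 // ltW.
have [n n_gt0] := walk_irreducible c_walk x y.
exists n; rewrite iter_step_twist mulr_gt0 ?invr_gt0 //.
have -> : (fun z => h z * delta y z) = (fun z => h y * delta y z).
  by apply: funext => z; rewrite /delta; case: eqP => [->|_]; rewrite ?mulr0.
by rewrite (posopZ (posop_iter (step_posop c_walk) n)) mulr_gt0.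
Qed.

Lemma twist_stochastic : (forall k, tilt S c u phi k = phi k) -> stochastic S twist.
Proof.
move=> harm k; rewrite /twist -big_distrl /= -tiltE harm divff //.
exact: lt0r_neq0.
Qed.

Lemma green_twist y g : green_function S c y g ->
  green_function S twist y (fun x => g x * h y / h x).
Proof.
move=> [gE g_ge0 [Phi [rho [rho_ge0 rho_lt1 gPhi PPhi]]]]; split.
- move=> x; rewrite step_twist.
  have -> : (fun z => h z * (g z * h y / h z)) = (fun z => h y * g z).
    by apply: funext => z; field.
  rewrite (posopZ (step_posop c_walk)) {1}gE /delta.
  by case: eqP => [->|_] /=; field.
- by move=> x; rewrite !mulr_ge0 ?invr_ge0 // ltW.
- exists (fun x => Phi x * h y / h x), rho; split => // x.
    by rewrite ler_pM2r ?invr_gt0 // ler_pM2r.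
  rewrite step_twist /=.
  have -> : (fun z => h z * (Phi z * h y / h z)) = (fun z => h y * Phi z).
    by apply: funext => z; field.
  rewrite (posopZ (step_posop c_walk)).
  have -> : (h x)^-1 * (h y * P Phi x) = P Phi x * (h y / h x) by ring.
  have -> : rho * (Phi x * h y / h x) = rho * Phi x * (h y / h x) by ring.
  by rewrite ler_pM2r ?divr_gt0.
Qed.

(** Exponents add under Doob transforms, so subexponents of the transform are subexponents of the
    original chain. *)
Lemma exp_fun_twist u' phi' k :
  tilt S twist u' phi' k * phi k = tilt S c (u + u') (fun j => phi j * phi' j) k.
Proof.
rewrite !tiltE big_distrl /=; apply: eq_bigr => a _.
rewrite /twist /exp_fun dotpDl expRD; field.
by rewrite lt0r_neq0.
Qed.

End Twist.

(** * Velocity and the choice of exponents *)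

Section Velocity.
Context {R : realType} {d N : nat}.
Local Notation E := (thick d N).
Context (S : seq E) (c : 'I_N -> E -> R).
Context (c_walk : irreducible_walk S c) (c_stoch : stochastic S c).

Lemma exp_testE w t (G : 'I_N -> 'rV[R]_d) :
  exp_test G w t = exp_fun (t *: w) (fun k => expR (t * dotp w (G k))) :> (E -> R).
Proof.
by apply: funext => x; rewrite /exp_test /exp_fun -expRD dotpZl -mulrDr -dotpDr.
Qed.

(** To first order a tilt by [t *: w] multiplies mass by [1 + t * dotp w v]; the correction [G]
    provides the type part, and a small [t] makes the quadratic error harmless. *)
Lemma velocity_descent (v : 'rV[R]_d) G (w : 'rV[R]_d) :
  mean_velocity S c v G -> dotp w v < 0 ->
  exists t rho phi, [/\ 0 < t, 0 <= rho, rho < 1, forall k, 0 < phi k &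
    forall k, tilt S c (t *: w) phi k <= rho * phi k].
Proof.
move=> vG wv; have [B B_ge0 test] := exp_test_bound c_walk c_stoch vG w.
pose s := - dotp w v; have s_gt0 : 0 < s by rewrite oppr_gt0.
(* Besides [t * B <= 1/2], this gives [t * s <= 1/2], so the contraction factor is nonnegative, and
   a quadratic error of at most [t * s / 2]. *)
pose t := Num.min (1 / (2 * (B + s + 1))) (s / (4 * (B ^+ 2 + 1))).
have B1_gt0 : 0 < B + s + 1 by lra.
have B2_gt0 : 0 < B ^+ 2 + 1 by rewrite ltr_wpDl // sqr_ge0.
have t_gt0 : 0 < t by rewrite lt_min !divr_gt0 ?mulr_gt0.
have tBs : t * (B + s + 1) <= 1/2.
  rewrite -ler_pdivlMr //; have -> : 1 / 2 / (B + s + 1) = 1 / (2 * (B + s + 1)).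
    by field; rewrite lt0r_neq0.
  by rewrite ge_min lexx.
have tB : t * B <= 1/2 by nra.
have ts : t * s <= 1/2 by nra.
have tB2 : 2 * (t * B) ^+ 2 <= t * s / 2.
  have : t * (4 * (B ^+ 2 + 1)) <= s.
    by rewrite -ler_pdivlMr ?mulr_gt0 // ge_min lexx orbT.
  by rewrite exprMn; nra.
have ts_gt0 : 0 < t * s by rewrite mulr_gt0.
exists t, (1 - t * s / 2), (fun k => expR (t * dotp w (G k))); split => // [||k|k].
- by lra.
- by lra.
- exact: expR_gt0.
have := test t (ltW t_gt0) tB (0, k); rewrite exp_testE exp_fun0 => /le_trans; apply.
by rewrite ler_pM2r ?expR_gt0 //; rewrite /s in tB2 *; lra.
Qed.

(** Converse of [velocity_descent]: at a maximum of [m], the bound [1 + z <= expR z] gives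
    [1 + dotp u v <= rho]. *)
Lemma velocity_lt0 (k0 : 'I_N) (v : 'rV[R]_d) G u phi rho :
  mean_velocity S c v G -> (forall k, 0 < phi k) -> rho < 1 ->
  (forall k, tilt S c u phi k <= rho * phi k) -> dotp u v < 0.
Proof.
move=> vG phi_gt0 rho_lt1 sub.
pose m k := dotp u (G k) - ln (phi k).
have [k k_max] := ex_argmax k0 m.
have mk := type_op_le_max c_walk c_stoch k_max.
suff : 1 + (dotp u v + m k - type_op S c m k) <= rho by lra.
rewrite -(ler_pM2r (phi_gt0 k)); apply: le_trans (sub k).
have -> : 1 + (dotp u v + m k - type_op S c m k) =
    \sum_(a <- S) c k a * (1 + (dotp u (position a) + ln (phi a.2) - ln (phi k))).
  rewrite -(vG k) dotp_sumr /type_op -{1}(c_stoch k) -[m k]mul1r -{1}(c_stoch k).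
  rewrite big_distrl -big_split -sumrB -big_split /=; apply: eq_bigr => a _.
  by rewrite dotpZr !(dotpBr, dotpDr) /m; ring.
rewrite tiltE big_distrl /=; apply: ler_sum => a _.
rewrite -mulrA ler_wpM2l ?(walk_ge0 c_walk) // /exp_fun -ler_pdivlMr //.
apply: le_trans (expR_ge1Dx _) _.
by rewrite expRD expRD expRN !lnK ?posrE.
Qed.

(** Coordinatewise maximum principle for the difference of the two corrections. *)
Lemma mean_velocity_unique (k0 : 'I_N) (v v' : 'rV[R]_d) G G' :
  mean_velocity S c v G -> mean_velocity S c v' G' -> v = v'.
Proof.
move=> vG vG'.
have le_vel (w w' : 'rV[R]_d) H H' i : mean_velocity S c w H ->
    mean_velocity S c w' H' -> w 0 i <= w' 0 i.
  move=> wH wH'; pose m k := H k 0 i - H' k 0 i.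
  have [k k_max] := ex_argmax k0 m.
  have := type_op_le_max c_walk c_stoch k_max.
  suff -> : type_op S c m k = w 0 i - w' 0 i + m k by lra.
  rewrite -(wH k) -(wH' k) !summxE /type_op -[m k]mul1r -{1}(c_stoch k) big_distrl.
  rewrite -sumrB -big_split /=; apply: eq_bigr => a _.
  by rewrite !mxE /m; ring.
apply/rowP => i; apply/eqP; rewrite eq_le.
by rewrite (le_vel _ _ _ _ i vG vG') (le_vel _ _ _ _ i vG' vG).
Qed.

End Velocity.

Section Direction.
Context {R : realType} {d N : nat}.
Local Notation E := (thick d N).
Context (S : seq E) (c : 'I_N -> E -> R) (k0 : 'I_N).
Context (c_walk : irreducible_walk S c) (c_stoch : stochastic S c).
Context (v0 : 'rV[R]_d) (G0 : 'I_N -> 'rV[R]_d) (v0G0 : mean_velocity S c v0 G0).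
Context (v0_neq0 : v0 <> 0).

Definition direction_exponent (theta : 'rV[R]_d) u phi : Prop :=
  [/\ forall k, 0 < phi k, forall k, tilt S c u phi k = phi k &
    exists (sp : R) G, 0 < sp /\ mean_velocity S (twist c u phi) (sp *: theta) G].

(** The velocity is nonzero, so tilting against it contracts. *)
Lemma contracting_exponent : exists u phi rho, [/\ forall k, 0 < phi k, 0 <= rho, rho < 1 &
  forall k, tilt S c u phi k <= rho * phi k].
Proof.
have v0v0 : dotp (- v0) v0 < 0.
  rewrite dotpC dotpNr oppr_lt0 lt_neqAle dotpp_ge0 andbT eq_sym.
  by apply/eqP => /dotpp_eq0.
have [t [rho [phi [t_gt0 rho_ge0 rho_lt1 phi_gt0 sub]]]] :=
  velocity_descent c_walk c_stoch v0G0 v0v0.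
by exists (t *: - v0), phi, rho.
Qed.

(** Take the subexponent extremal in the direction [theta]. It is harmonic, and first-order
    optimality says that the half-space of descent directions for the velocity lies in that of
    [theta], so the two vectors are parallel. *)
Lemma direction_exponent_exists (theta : 'rV[R]_d) : enorm theta = 1 ->
  exists u phi, direction_exponent theta u phi.
Proof.
move=> theta1; have [us [ps [rho [ps_gt0 rho_ge0 rho_lt1 ps_sub]]]] := contracting_exponent.
have ps_subexp : subexponent S c us ps.
  split => // k; apply: le_trans (ps_sub k) _.
  by rewrite ler_piMl // ltW.
have [u [phi [sub max]]] := subexponent_max c_walk k0 theta ps_subexp.
have theta_neq0 : theta != 0 by rewrite -enorm_eq0 theta1 oner_eq0.
have harm := subexponent_max_harmonic c_walk theta_neq0 sub max.
have [phi_gt0 _] := sub.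
have tw_walk := twist_walk c_walk u phi_gt0.
have tw_stoch := twist_stochastic phi_gt0 harm.
have [v [G vG]] := mean_velocity_exists tw_walk tw_stoch k0.
(* Seen from the transform, [us - u] is still a contracting exponent, which a zero velocity would
   forbid. *)
have v_neq0 : v <> 0.
  move=> v_eq0; pose q k := ps k / phi k.
  have : dotp (us - u) v < 0.
    apply: (velocity_lt0 tw_walk tw_stoch k0 vG (phi := q) _ rho_lt1) => k.
      by rewrite divr_gt0.
    rewrite -(ler_pM2r (phi_gt0 k)) exp_fun_twist // addrC subrK.
    have -> : (fun j => phi j * q j) = ps.
      by apply: funext => j; rewrite mulrC divfK // lt0r_neq0.
    by rewrite -mulrA divfK // lt0r_neq0.
  by rewrite v_eq0 dotp0r ltxx.
have cone w : dotp w v < 0 -> dotp w theta <= 0.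
  move=> wv; have [t [rh [ps' [t_gt0 rh_ge0 rh_lt1 ps'_gt0 ps'_sub]]]] :=
    velocity_descent tw_walk tw_stoch vG wv.
  have /max : subexponent S c (u + t *: w) (fun j => phi j * ps' j).
    split => k; first by rewrite mulr_gt0.
    rewrite -exp_fun_twist // [leRHS]mulrC ler_pM2r //.
    by apply: le_trans (ps'_sub k) _; rewrite ler_piMl // ltW.
  by rewrite dotpDl dotpZl gerDl pmulr_rle0.
exists u, phi; split => //; exists (enorm v), G.
have v_gt0 : 0 < enorm v.
  rewrite lt_neqAle enorm_ge0 andbT eq_sym enorm_eq0.
  exact/eqP.
split => //; suff -> : enorm v *: theta = v by [].
(* Were [w] nonzero, it would satisfy both [dotp w v < 0] and [dotp w theta > 0], against [cone]. *)
apply/eqP; rewrite -subr_eq0; apply/eqP; set w := _ - v.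
have thth : dotp theta theta = 1 by rewrite -sqr_enorm theta1 expr1n.
have ww : dotp w w = 2 * enorm v * (enorm v - dotp v theta).
  rewrite /w !(dotpBr, dotpZr) (dotpC _ theta) (dotpC _ v) !(dotpBr, dotpZr).
  by rewrite thth -sqr_enorm (dotpC theta v); ring.
have wth : dotp w theta = enorm v - dotp v theta.
  by rewrite dotpC /w !(dotpBr, dotpZr) thth (dotpC theta v); ring.
have wv : dotp w v = - (enorm v * (enorm v - dotp v theta)).
  by rewrite dotpC /w !(dotpBr, dotpZr) -sqr_enorm; ring.
apply: dotpp_eq0; apply/eqP; rewrite eq_le dotpp_ge0 andbT ww.
rewrite leNgt; apply/negP; rewrite pmulr_rgt0 ?mulr_gt0 // => gap.
have : dotp w v < 0 by rewrite wv oppr_lt0 mulr_gt0.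
by move=> /cone; rewrite wth leNgt gap.
Qed.

(* The exponent determines the Doob transform, hence its direction of escape. *)
Lemma direction_exponent_inj (th1 th2 : 'rV[R]_d) u1 phi1 u2 phi2 (l : R) :
  enorm th1 = 1 -> enorm th2 = 1 ->
  direction_exponent th1 u1 phi1 -> direction_exponent th2 u2 phi2 ->
  (forall x : E, exp_fun u1 phi1 x = l * exp_fun u2 phi2 x) -> th1 = th2.
Proof.
move=> th1_1 th2_1 [p1_gt0 harm1 [s1 [G1 [s1_gt0 vG1]]]] [p2_gt0 harm2 [s2 [G2 [s2_gt0 vG2]]]] hE.
have tw : twist c u1 phi1 = twist c u2 phi2.
  apply: funext => k; apply: funext => a; rewrite /twist hE.
  have := hE (0, k); rewrite !exp_fun0 => p1E.
  have l_neq0 : l != 0.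
    by apply/eqP => l0; have := p1_gt0 k; rewrite p1E l0 mul0r ltxx.
  by rewrite p1E; field; rewrite l_neq0 lt0r_neq0.
rewrite tw in vG1.
have vE := mean_velocity_unique (twist_walk c_walk u2 p2_gt0)
  (twist_stochastic p2_gt0 harm2) k0 vG1 vG2.
have sE : s1 = s2.
  have := congr1 enorm vE; rewrite !enormZ th1_1 th2_1 !mulr1.
  by rewrite !gtr0_norm.
by move: vE; rewrite sE => /(scalerI (lt0r_neq0 s2_gt0)).
Qed.

End Direction.

Lemma cvg_bigsum {R : realType} {T I : Type} (F : set_system T) (FF : Filter F)
    (s : seq I) (f : I -> T -> R) (l : I -> R) :
  (forall i, f i x @[x --> F] --> l i) ->
  \sum_(i <- s) f i x @[x --> F] --> \sum_(i <- s) l i.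
Proof.
move=> fl; elim: s => [|i s IHs].
  rewrite big_nil; under eq_fun do rewrite big_nil.
  exact: cvg_cst.
rewrite big_cons; under eq_fun do rewrite big_cons.
exact: cvgD.
Qed.

(** * From kernels to walks *)

Section LatticeKernel.
Context {R : realType} {d N : nat}.
Local Notation E := (thick d N).
Context (p : E -> E -> R).

Lemma lattice_support : finitely_supported p -> exists X : seq 'rV[int]_d,
  uniq X /\ forall k j x, x \notin X -> p (0, k) (x, j) = 0.
Proof.
move=> fin; have [s sP] : exists s : 'I_N * 'I_N -> seq 'rV[int]_d,
    forall kj, [set x | p (0, kj.1) (x, kj.2) != 0] = [set` s kj].
  suff /choice[s sP] : forall kj : 'I_N * 'I_N, exists s : seq 'rV[int]_d,
      [set x | p (0, kj.1) (x, kj.2) != 0] = [set` s] by exists s.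
  by move=> kj; apply/finite_seqP; exact: fin.
exists (undup (flatten [seq s kj | kj <- enum [set: 'I_N * 'I_N]%SET])).
split=> [|k j x]; first exact: undup_uniq.
rewrite mem_undup => xs; apply/eqP/negPn/negP => px.
move/negP: xs; apply; apply/flatten_mapP; exists (k, j); first by rewrite mem_enum inE.
by have := congr1 (fun A => A x) (sP (k, j)); rewrite /= => <-.
Qed.

Context (p_markov : markov_kernel p) (p_irreducible : irreducible_kernel p)
  (p_invariant : lattice_invariant p).
Context (X : seq 'rV[int]_d) (X_uniq : uniq X)
  (X_supp : forall k j x, x \notin X -> p (0, k) (x, j) = 0).

Definition jumps : seq E := [seq (x, j) | x <- X, j <- enum 'I_N].

Definition jump_weight (k : 'I_N) (a : E) : R := p (0, k) a.

Local Notation P := (step_op jumps jump_weight).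

Lemma big_jumps (V : nmodType) (F : E -> V) :
  \sum_(a <- jumps) F a = \sum_(x <- X) \sum_j F (x, j).
Proof. by rewrite big_allpairs; apply: eq_bigr => x _; rewrite big_enum. Qed.

Lemma jumps_uniq : uniq jumps.
Proof. by apply: allpairs_uniq => //; [exact: enum_uniq | move=> [? ?] [? ?]]. Qed.

Lemma jump_weight0 k a : a \notin jumps -> jump_weight k a = 0.
Proof.
case: a => x j aX; apply: X_supp; apply: contra aX => xX.
by apply/allpairsP; exists (x, j); split => //; rewrite mem_enum.
Qed.

Lemma kernel_sumE f x : \sum_(y \in [set: E]) p x y * f y = P f x.
Proof.
have bij_shift : bijective (shift x).
  exists (shift (- x.1, x.2)) => -[y j]; rewrite /shift /=.
    by rewrite addKr.
  by rewrite addNKr.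
rewrite (reindex_fsbigT _ (fun y => p x y * f y) bij_shift).
have pE a : p x (shift x a) = jump_weight x.2 a.
  case: x a {bij_shift} => x k [y j]; rewrite p_invariant /= /jump_weight.
  by rewrite addrC addKr.
rewrite (fsbigE jumps) //; last first.
- by move=> a _ aX; rewrite pE jump_weight0 // mul0r.
- exact: jumps_uniq.
by rewrite /step_op; apply: eq_big => a; rewrite ?in_setT // pE.
Qed.

Lemma nstepE n x y : nstep p n x y = iter n P (delta y) x.
Proof.
elim: n x => [//|n IHn] x /=; rewrite -kernel_sumE.
by apply: eq_fsbigr => z _; rewrite IHn.
Qed.

Lemma jump_walk : irreducible_walk jumps jump_weight.
Proof.
split => [k a|x y]; first by have [p_ge0 _ _] := p_markov; exact: p_ge0.
by have [n n_gt0] := p_irreducible x y; exists n; rewrite -nstepE.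
Qed.

Lemma jump_stochastic : stochastic jumps jump_weight.
Proof.
move=> k; have [_ _ /(_ (0, k)) <-] := p_markov.
transitivity (P (fun=> 1) (0, k)).
  by apply: eq_bigr => a _; rewrite mulr1.
by rewrite -kernel_sumE; apply: eq_fsbigr => y _; rewrite mulr1.
Qed.

Lemma induced_chainE k j : induced_chain p k j = \sum_(x <- X) jump_weight k (x, j).
Proof.
rewrite /induced_chain (fsbigE X) //; last by move=> x _; exact: X_supp.
by apply: eq_big => // x; rewrite in_setT.
Qed.

Lemma stationary_type_op nu (phi : 'I_N -> R) : stationary_probability (induced_chain p) nu ->
  \sum_k nu k * type_op jumps jump_weight phi k = \sum_k nu k * phi k.
Proof.
move=> [_ _ nu_stat].
transitivity (\sum_k \sum_j nu k * (induced_chain p k j * phi j)).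
  apply: eq_bigr => k _; rewrite -big_distrr /=; congr (_ * _).
  rewrite /type_op big_jumps exchange_big /=; apply: eq_bigr => j _.
  by rewrite induced_chainE big_distrl.
rewrite exchange_big /=; apply: eq_bigr => j _.
by rewrite -[in RHS]nu_stat big_distrl /=; apply: eq_bigr => k _; rewrite mulrA.
Qed.

(** Averaging the velocity equation over [nu] cancels the corrections by stationarity. Non-centering
    thus becomes a nonzero velocity. *)
Lemma mean_velocity_drift nu v G : stationary_probability (induced_chain p) nu ->
  mean_velocity jumps jump_weight v G -> drift p nu = v.
Proof.
move=> nu_stat vG; have [_ nu1 _] := nu_stat.
have -> : drift p nu = \sum_k nu k *: \sum_(a <- jumps) jump_weight k a *: position a.
  rewrite /drift (fsbigE X) //; last first.
    move=> x _ xX; rewrite big1 // => k _; rewrite big1 // => j _.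
    by rewrite X_supp // mulr0 scale0r.
  rewrite (eq_bigl xpredT); last by move=> x; rewrite in_setT.
  rewrite exchange_big /=; apply: eq_bigr => k _.
  rewrite big_jumps scaler_sumr; apply: eq_bigr => x _.
  by rewrite scaler_sumr; apply: eq_bigr => j _; rewrite scalerA.
apply/rowP => i; pose m k := G k 0 i.
have vE k : v 0 i = (\sum_(a <- jumps) jump_weight k a *: position a : 'rV[R]_d) 0 i
    + type_op jumps jump_weight m k - m k.
  rewrite -(vG k) !summxE /type_op -[m k]mul1r -{1}(jump_stochastic k) big_distrl.
  rewrite -big_split -sumrB /=; apply: eq_bigr => a _.
  by rewrite !mxE /m; ring.
rewrite summxE -[RHS]mul1r -nu1 big_distrl /=.
have := stationary_type_op m nu_stat => stat.
transitivity (\sum_k nu k * (\sum_(a <- jumps) jump_weight k a *: position a : 'rV[R]_d) 0 i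
  + (\sum_k nu k * type_op jumps jump_weight m k - \sum_k nu k * m k)).
  rewrite stat subrr addr0; apply: eq_bigr => k _.
  by rewrite mxE.
rewrite -sumrB -big_split; apply: eq_bigr => k _ /=.
by rewrite (vE k); ring.
Qed.

(** Since [delta y] is at most [Phi / Phi y], its iterates are dominated by a geometric series; the
    limit inherits the Green equation and the domination. *)
Lemma green_function_of_contraction (Phi : E -> R) (rho : R) :
  (forall x, 0 < Phi x) -> 0 <= rho -> rho < 1 ->
  (forall x, P Phi x <= rho * Phi x) -> forall y, exists g,
    (forall x, green p x y = (g x)%:E) /\ green_function jumps jump_weight y g.
Proof.
move=> Phi_gt0 rho_ge0 rho_lt1 PPhi y.
have posP := step_posop jump_walk.
pose s n x := \sum_(0 <= i < n) iter i P (delta y) x.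
have iter_ge0 i x : 0 <= iter i P (delta y) x.
  by apply: (posop_ge0 (posop_iter posP i)) => z; exact: delta_ge0.
have s_homo x : {homo s^~ x : n m / (n <= m)%N >-> n <= m}.
  apply/nondecreasing_seqP => n; rewrite /s big_nat_recr //= lerDl.
  exact: iter_ge0.
have s_bound n x : s n x <= Phi x / Phi y / (1 - rho).
  have iter_le i : iter i P (delta y) x <= Phi x / Phi y * rho ^+ i.
    apply: (@le_trans _ _ (iter i P (fun z => (Phi y)^-1 * Phi z) x)).
      apply: (posop_le (posop_iter posP i)) => z; rewrite /delta.
      case: eqP => [->|_]; first by rewrite mulVf // lt0r_neq0.
      by rewrite mulr_ge0 ?invr_ge0 // ltW.
    rewrite (posopZ (posop_iter posP i)) [Phi x / _]mulrC -mulrA.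
    rewrite ler_pM2l ?invr_gt0 // mulrC.
    by rewrite [leRHS]mulrC mulrC; exact: (posop_iter_le_eigen posP).
  apply: (@le_trans _ _ (Phi x / Phi y * \sum_(i < n) rho ^+ i)).
    by rewrite /s big_mkord big_distrr /=; apply: ler_sum => i _.
  rewrite ler_pM2l ?divr_gt0 //; have := geometric_tail_le 0 n rho_ge0 rho_lt1.
  by rewrite expr0 div1r.
have s_cvg x : cvgn (s^~ x).
  apply: nondecreasing_is_cvgn => //.
  by exists (Phi x / Phi y / (1 - rho)) => _ [n _ <-].
pose g x := limn (s^~ x); exists g.
have g_cvg x : s n x @[n --> \oo] --> g x by exact: s_cvg.
split => [x|].
  rewrite /g -EFin_lim // /green; congr (limn _); apply: funext => n.
  by rewrite sumEFin /s /=; congr (_%:E); apply: eq_bigr => i _; rewrite nstepE.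
have g_ge0 x : 0 <= g x.
  apply: limr_ge => //; apply: nearW => n.
  by apply: sumr_ge0 => i _; exact: iter_ge0.
split => // [x|].
  have : s n.+1 x @[n --> \oo] --> g x by rewrite (cvg_shiftS (s^~ x)).
  have sS n : s n.+1 x = delta y x + P (s n) x.
    rewrite /s big_nat_recl //= (posop_sum posP); congr (_ + _).
  rewrite (funext sS) => gx.
  have gx' : delta y x + P (s n) x @[n --> \oo] --> delta y x + P g x.
    apply: cvgD; first exact: cvg_cst.
    by apply: cvg_bigsum => a; apply: cvgM; [exact: cvg_cst | exact: g_cvg].
  exact: (cvg_unique _ gx gx').
exists (fun x => Phi x / Phi y / (1 - rho)), rho; split => // [x|x].
  by apply: limr_le => //; apply: nearW => n; exact: s_bound.
have -> : (fun z => Phi z / Phi y / (1 - rho)) =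
    (fun z => ((Phi y)^-1 / (1 - rho)) * Phi z).
  by apply: funext => z; ring.
rewrite (posopZ posP).
have -> : rho * (Phi x / Phi y / (1 - rho)) = (Phi y)^-1 / (1 - rho) * (rho * Phi x).
  by ring.
rewrite ler_pM2l ?PPhi //.
by rewrite divr_gt0 ?invr_gt0 // subr_gt0.
Qed.

End LatticeKernel.

(** * Limits of the Martin kernel and their minimality *)

Section MartinLimits.
Context {R : realType} {d N : nat}.
Local Notation E := (thick d N).

(** A competitor divided by [h] is, up to scaling, a bounded harmonic function of the Doob
    transform, hence constant. *)
Lemma minimal_harmonic_twist (p : E -> E -> R) (S : seq E) c u phi (x0 : E) :
  (forall f x, \sum_(y \in [set: E]) p x y * f y = step_op S c f x) ->
  irreducible_walk S c -> (forall k, 0 < phi k) -> (forall k, tilt S c u phi k = phi k) ->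
  minimal_harmonic p (fun x => exp_fun u phi x / exp_fun u phi x0).
Proof.
move=> pE c_walk phi_gt0 harm; set h := exp_fun u phi.
have h_gt0 x : 0 < h x by exact: exp_fun_gt0.
have h_neq0 x : h x != 0 by rewrite lt0r_neq0.
have Ph x : step_op S c h x = h x.
  by rewrite /h step_exp_fun /exp_fun harm.
have tw_walk := twist_walk c_walk u phi_gt0.
have tw_stoch := twist_stochastic phi_gt0 harm.
split => [x|x|psi psi_harm psi_le].
- rewrite pE -[h x in LHS]Ph mulrC -(posopZ (step_posop c_walk)); congr (step_op _ _ _ _).
  by apply: funext => y; rewrite mulrC.
- by rewrite divr_ge0 // ltW.
pose f x := psi x * h x0 / h x.
have f01 x : 0 <= f x <= 1.
  have /andP[psi_ge0 psi_le1] := psi_le x.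
  apply/andP; split; first by rewrite divr_ge0 ?mulr_ge0 // ltW.
  by rewrite /f ler_pdivrMr // mul1r -ler_pdivlMr.
have f_harm x : step_op S (twist c u phi) f x = f x.
  rewrite step_twist //.
  have -> : (fun y => exp_fun u phi y * f y) = (fun y => h x0 * psi y).
    by apply: funext => y; rewrite /f -/h; field.
  rewrite (posopZ (step_posop c_walk)) -pE -psi_harm /f -/h.
  by field.
exists (f x0) => x.
rewrite (bounded_harmonic_cst tw_walk tw_stoch f_harm f01 x0 x) /f.
by field; rewrite !h_neq0.
Qed.

(** The Martin kernel is [h x / h x0] times a ratio of Green functions of the Doob transform in the
    direction [theta], and this ratio tends to 1. *)
Theorem martin_limits (p : E -> E -> R) (nu : 'I_N -> R) (x0 : E) :
  markov_kernel p -> irreducible_kernel p -> lattice_invariant p ->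
  finitely_supported p -> stationary_probability (induced_chain p) nu ->
  drift p nu <> 0 ->
  green_finite p /\ exists Kinf : sphere R d -> E -> R,
    [/\ forall theta x,
          martin_kernel p x0 x y @[y --> dir_filter (val theta)] --> Kinf theta x,
        injective Kinf & forall theta, minimal_harmonic p (Kinf theta)].
Proof.
move=> p_markov p_irr p_inv /lattice_support[X [X_uniq X_supp]] nu_stat drift_neq0.
pose S := jumps (N := N) X; pose c := jump_weight p.
have c_walk := jump_walk p_markov p_irr p_inv X_uniq X_supp.
have c_stoch := jump_stochastic p_markov p_inv X_uniq X_supp.
have [v [G vG]] := mean_velocity_exists c_walk c_stoch x0.2.
have v_neq0 : v <> 0.
  by rewrite -(mean_velocity_drift p_markov p_inv X_uniq X_supp nu_stat vG).
have [us [ps [rho [ps_gt0 rho_ge0 rho_lt1 ps_sub]]]] :=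
  contracting_exponent c_walk c_stoch vG v_neq0.
have Phi_gt0 x : 0 < exp_fun us ps x by exact: exp_fun_gt0.
have PPhi x : step_op S c (exp_fun us ps) x <= rho * exp_fun us ps x.
  by rewrite step_exp_fun /exp_fun mulrCA ler_pM2l ?expR_gt0.
have [g gP] := choice (green_function_of_contraction p_markov p_irr p_inv X_uniq X_supp
  Phi_gt0 rho_ge0 rho_lt1 PPhi).
have gE x y : green p x y = (g y x)%:E by have [] := gP y.
split=> [x y|]; first by rewrite gE ltry.
have exponent (theta : sphere R d) : exists uphi,
    direction_exponent S c (val theta) uphi.1 uphi.2.
  have theta1 : enorm (val theta) = 1 by apply/eqP; exact: (valP theta).
  have [u [phi h]] := direction_exponent_exists x0.2 c_walk c_stoch vG v_neq0 theta1.
  by exists (u, phi).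
have [e eP] := choice exponent.
pose h theta := exp_fun (e theta).1 (e theta).2 : E -> R.
have h_gt0 theta x : 0 < h theta x by have [phi_gt0 _ _] := eP theta; exact: exp_fun_gt0.
have h_neq0 theta x : h theta x != 0 by rewrite lt0r_neq0.
exists (fun theta x => h theta x / h theta x0); split => [theta x|th1 th2 hE|theta].
- have [phi_gt0 harm [sp [G' [sp_gt0 vG']]]] := eP theta.
  have theta1 : enorm (val theta) = 1 by apply/eqP; exact: (valP theta).
  have gr_green y := green_twist c_walk (e theta).1 phi_gt0 (proj2 (gP y)).
  have lim := green_ratio_cvg (twist_walk c_walk (e theta).1 phi_gt0)
    (twist_stochastic phi_gt0 harm) theta1 sp_gt0 vG' gr_green x x0.
  rewrite -[_ / _ in X in _ --> X]mul1r.
  apply: cvg_trans (cvgM lim (cvg_cst (h theta x / h theta x0))).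
  apply: near_eq_cvg; apply: nearW => y; rewrite /martin_kernel !gE /= -/(h theta _).
  have g0 : g y x0 != 0.
    have gy := green_superharmonic (proj2 (gP y)).
    rewrite lt0r_neq0 //; apply: (superharmonic_gt0 c_walk gy (y := y)).
    by apply: lt_le_trans (green_diag c_walk (proj2 (gP y))).
  by rewrite -!/(h theta _); field; rewrite !h_neq0 g0.
- apply: val_inj; have th1_1 : enorm (val th1) = 1 by apply/eqP; exact: (valP th1).
  have th2_1 : enorm (val th2) = 1 by apply/eqP; exact: (valP th2).
  apply: (direction_exponent_inj x0.2 c_walk th1_1 th2_1 (eP th1) (eP th2)
    (l := h th1 x0 / h th2 x0)) => x.
  have := congr1 (fun K => K x) hE => /= hx; rewrite -/(h th1 x) -/(h th2 x).
  by rewrite -[LHS](divfK (h_neq0 th1 x0)) hx; field.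
- have [phi_gt0 harm _] := eP theta.
  apply: (minimal_harmonic_twist x0 _ c_walk phi_gt0 harm).
  by move=> f x; exact: kernel_sumE.
Qed.

End MartinLimits.

(** * Comparison of compactifications *)

Section Compactifications.
Context {R : realType} {E : choiceType}.

Lemma dense_nbhs (M : topologicalType) (iota : E -> M) (xi : M) (A : set M) :
  dense (range iota) -> nbhs xi A -> exists y, A (iota y).
Proof.
move=> dns nA; have [z [Az [y _ yz]]] : A° `&` range iota !=set0.
  by apply: dns; [exists xi; exact: nbhs_singleton (nbhs_interior nA) | exact: open_interior].
by exists y; rewrite yz; exact: interior_subset Az.
Qed.

Lemma dense_eq (M T : topologicalType) (iota : E -> M) (f g : M -> T) :
  dense (range iota) -> hausdorff_space T -> continuous f -> continuous g ->
  (forall y, f (iota y) = g (iota y)) -> forall xi, f xi = g xi.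
Proof.
move=> dns hT cf cg fg xi; apply: hT => A B nA nB.
have nfA : nbhs xi (f @^-1` A) by exact: cf nA.
have ngB : nbhs xi (g @^-1` B) by exact: cg nB.
have [y [Ay By]] := dense_nbhs dns (filterI nfA ngB).
by exists (f (iota y)); split => //; rewrite fg.
Qed.

Section Smallest.
Context (K : E -> E -> R).
Context (M M' : topologicalType) (iota : E -> M) (iota' : E -> M').
Context (Kt : E -> M -> R) (Kt' : E -> M' -> R).
Context (cM : compactification iota) (cM' : compactification iota').
Context (KtM : continuous_extension K iota Kt) (KtM' : continuous_extension K iota' Kt').
Context (separated : forall xi1 xi2, ~ range iota xi1 -> ~ range iota xi2 ->
  (forall x, Kt x xi1 = Kt x xi2) -> xi1 = xi2).

(* The closure in M' * M of the diagonal copy of E; it is the graph of a map. *)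
Let related (xi' : M') (xi : M) : Prop := forall A B, nbhs xi' A -> nbhs xi B ->
  exists y, A (iota' y) /\ B (iota y).

(** The neighbourhoods of [xi'], traced on [E] and pushed to [M], form a filter that has a cluster
    point by compactness. *)
Let related_exists xi' : exists xi, related xi' xi.
Proof.
pose F : set_system M := [set B | exists2 A, nbhs xi' A & forall y, A (iota' y) -> B (iota y)].
have FF : ProperFilter F.
  apply: Build_ProperFilter_ex => [B [A nA AB]|].
    have [y Ay] := dense_nbhs (compactification_dense cM') nA.
    by exists (iota y); exact: AB.
  split.
  - by exists setT => //; exact: filterT.
  - move=> B1 B2 [A1 nA1 AB1] [A2 nA2 AB2].
    by exists (A1 `&` A2) => [|y [/AB1 ? /AB2 ?]] //; exact: filterI.
  - by move=> B1 B2 B12 [A nA AB]; exists A => // y /AB/B12.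
have [xi [_ xiP]] := compactification_compact cM FF filterT.
exists xi => A B nA nB.
have FA : F [set iota y | y in [set y | A (iota' y)]].
  by exists A => // y Ay; exists y.
by have [_ [[y Ay <-] By]] := xiP _ _ FA nB; exists y.
Qed.

Let related_iota x xi : related (iota' x) xi -> xi = iota x.
Proof.
move=> rel; apply: (compactification_hausdorff cM) => A B nA nB.
have nx : nbhs (iota' x) [set iota' x].
  by apply: open_nbhs_nbhs; split => //; exact: (compactification_open cM').
have [y [/(compactification_inj cM') -> Ax]] := rel _ _ nx nA.
by exists (iota x); split => //; exact: nbhs_singleton.
Qed.

(** Points of [E] are isolated in both spaces, so boundary is related to boundary; there both
    extended kernels are limits of the same values of [K]. *)
Let related_boundary xi' xi : ~ range iota' xi' -> related xi' xi ->
  ~ range iota xi /\ forall x, Kt x xi = Kt' x xi'.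
Proof.
move=> xi'_bd rel; split => [[x _ xE]|x].
  apply: xi'_bd; exists x => //; apply: (compactification_hausdorff cM') => A B nA nB.
  have nx : nbhs xi [set xi].
    by apply: open_nbhs_nbhs; split => //; rewrite -xE; exact: (compactification_open cM).
  have [y [By yE]] := rel _ _ nB nx; exists (iota' x); split; first exact: nbhs_singleton.
  by have <- : y = x by apply: (compactification_inj cM); rewrite yE.
have [[KtE Kt_cont] [Kt'E Kt'_cont]] := (KtM, KtM').
apply: (@Rhausdorff R) => A B nA nB.
have [y [By Ay]] := rel _ _ (Kt'_cont x xi' _ nB) (Kt_cont x xi _ nA).
by exists (K x y); split; [rewrite -KtE | rewrite -Kt'E].
Qed.

Let related_unique xi' xi1 xi2 : related xi' xi1 -> related xi' xi2 -> xi1 = xi2.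
Proof.
have [[x _ <-]|bd] := pselect (range iota' xi'); first by move=> /related_iota -> /related_iota ->.
move=> /(related_boundary bd)[bd1 E1] /(related_boundary bd)[bd2 E2].
by apply: separated => // x; rewrite E1 E2.
Qed.

(** The relation is a function by [separated]. If it were discontinuous at [xi'], images of nearby
    points outside [B°] would cluster at a point related to [xi'], hence at [f xi'], which is
    interior to [B]. *)
Lemma compactification_map : exists2 f : M' -> M, continuous f &
  forall x, f (iota' x) = iota x.
Proof.
have [f fP] := choice related_exists; exists f => [xi' B nB|x]; last exact: related_iota.
apply: contrapT => nfB.
pose G : set_system M' := within (~` (f @^-1` B°)) (nbhs xi').
have G_proper : ProperFilter G.
  apply: Build_ProperFilter_ex => A GA; apply: contrapT => A0; apply: nfB.
  apply: (filterS (F := nbhs xi') _ GA) => eta Aeta; apply: contrapT => fB.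
  by apply: A0; exists eta; apply: Aeta => /interior_subset.
have [xi [_ xiP]] := compactification_compact cM (fmap_proper_filter f G_proper) filterT.
have rel : related xi' xi.
  move=> A C nA nC.
  have GA : (f @ G) [set f eta | eta in A° `&` ~` (f @^-1` B°)].
    apply: filterS (nbhs_interior nA) => eta Aeta nfBeta /=.
    by exists eta.
  have [_ [[eta [Aeta _] <-] Ceta]] := xiP _ _ GA (nbhs_interior nC).
  have [||y [/interior_subset Ay /interior_subset Cy]] := fP eta A° C°.
  - exact: nbhs_interior.
  - exact: nbhs_interior.
  - by exists y.
have xiE : xi = f xi' by exact: related_unique rel (fP xi').
have GB : (f @ G) (~` B°) by apply: (nearW (F := nbhs xi')) => eta.
have [z [nBz Bz]] := xiP _ _ GB (nbhs_interior (nbhs_interior (eq_ind_r (nbhs^~ B) nB xiE))).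
by apply: nBz; exact: interior_subset.
Qed.

End Smallest.

(** Minimality gives maps both ways; their composites, and the two kernels, agree on the dense
    subset [E]. *)
Lemma martin_compactifications_coincide (p : E -> E -> R) (x0 : E)
    (M M' : topologicalType) (iota : E -> M) (iota' : E -> M')
    (Kt : E -> M -> R) (Kt' : E -> M' -> R) :
  martin_compactification p x0 iota Kt -> martin_compactification p x0 iota' Kt' ->
  exists f : M -> M', exists g : M' -> M,
    [/\ [/\ continuous f, continuous g, cancel f g, cancel g f &
            forall x, f (iota x) = iota' x] &
        forall x xi, Kt x xi = Kt' x (f xi)].
Proof.
move=> mM mM'; have [cM cM'] := (martin_compact mM, martin_compact mM').
have [eM eM'] := (martin_extension mM, martin_extension mM').
have [f f_cont fE] := martin_smallest mM' cM eM.
have [g g_cont gE] := martin_smallest mM cM' eM'.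
exists f, g; split; first split => //.
- move=> xi; apply: (dense_eq (f := g \o f) (g := id) (compactification_dense cM)
    (compactification_hausdorff cM)) => [z|z|y] /=; last by rewrite fE gE.
    by apply: continuous_comp; [exact: f_cont | exact: g_cont].
  exact: cvg_id.
- move=> xi; apply: (dense_eq (f := f \o g) (g := id) (compactification_dense cM')
    (compactification_hausdorff cM')) => [z|z|y] /=; last by rewrite gE fE.
    by apply: continuous_comp; [exact: g_cont | exact: f_cont].
  exact: cvg_id.
have [[KtE Kt_cont] [Kt'E Kt'_cont]] := (eM, eM').
move=> x; apply: (dense_eq (compactification_dense cM) (@Rhausdorff R) (Kt_cont x)
  (g := Kt' x \o f)) => [z|y] /=; last by rewrite fE KtE Kt'E.
by apply: continuous_comp; [exact: f_cont | exact: Kt'_cont].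
Qed.

End Compactifications.

(** * The CAT(0) compactification *)

Section Cat0.
Context {R : realType} {d N : nat} (k0 : 'I_N).
Local Notation E := (thick d N).
Local Notation cat0E := (cat0 R d N).

Lemma sphere_enorm (theta : sphere R d) : enorm (val theta) = 1.
Proof. exact/eqP/(valP theta). Qed.

Lemma enorm_direction (a : E) : 0 < enorm (position a : 'rV[R]_d) ->
  enorm (direction a : 'rV[R]_d) = 1.
Proof. by move=> a_gt0; rewrite enormZ gtr0_norm ?invr_gt0 // mulVf // lt0r_neq0. Qed.

(** Round [t *: theta] to the lattice, for [t] large. *)
Lemma direction_approx (theta : 'rV[R]_d) (del r : R) : enorm theta = 1 -> 0 < del ->
  exists a : E, r < enorm (position a : 'rV[R]_d) /\ `|direction a - theta| < del.
Proof.
move=> theta1 del_gt0.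
(* The rounding error has sup norm at most 1 and changes the length by at most [3 * d%:R]; so the
   direction is off by at most [C / Y], and [t] makes [Y] exceed both [r] and [C / del]. *)
pose C := 1 + 3 * d%:R : R; have C_ge1 : 1 <= C by rewrite lerDl mulr_ge0.
pose t := 1 + C + `|r| + C / del.
have Cdel_gt0 : 0 < C / del by rewrite divr_gt0 //; lra.
have t_ge1 : 1 <= t by rewrite /t; have := normr_ge0 r; lra.
pose a : E := (\row_i Num.floor (t * theta 0 i), k0).
have [w wE] : exists w : 'rV[R]_d, w = position a - t *: theta by eexists.
have w_le i : `|w 0 i| <= 1.
  rewrite wE !mxE /= ler_norml; have /andP[] := floor_itv (t * theta 0 i).
  by rewrite intrD; lra.
set Y := enorm (position a : 'rV[R]_d).
have Y_ge0 : 0 <= Y by exact: enorm_ge0.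
have posE : position a = t *: theta + w :> 'rV[R]_d by rewrite wE addrC subrK.
have th_le i : `|theta 0 i| <= 1.
  by rewrite -theta1; apply: le_trans (norm_coord_le theta i) _; exact: norm_le_enorm.
have d_ge1 : 1 <= d%:R :> R.
  rewrite ler1n lt0n; apply/negP => /eqP d0; move: theta1.
  rewrite enormE /dotp big1 => [|i _]; last by have := ltn_ord i; rewrite {2}d0.
  by rewrite sqrtr0; move/eqP; rewrite eq_sym oner_eq0.
have YE : Y ^+ 2 = t ^+ 2 + 2 * t * dotp theta w + dotp w w.
  rewrite sqr_enorm posE !(dotpDl, dotpDr, dotpZl, dotpZr) -(sqr_enorm theta) theta1.
  by rewrite (dotpC w theta); ring.
have dot_le (v : 'rV[R]_d) : (forall i, `|v 0 i| <= 1) -> `|dotp v w| <= d%:R.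
  move=> v_le; apply: le_trans (ler_norm_sum _ _ _) _.
  apply: (@le_trans _ _ (\sum_(i < d) 1)); last by rewrite sumr_const card_ord.
  by apply: ler_sum => i _; rewrite normrM mulr_ile1.
have tw := dot_le _ th_le; have ww := dot_le _ w_le.
(* Factor [Y ^+ 2 - t ^+ 2]: its absolute value is at most [(2 * t + 1) * d%:R], and [1 <= t]. *)
have Yt : `|Y - t| <= 3 * d%:R.
  have sum_gt0 : 0 < Y + t by lra.
  have prodE : `|Y - t| * (Y + t) = `|2 * t * dotp theta w + dotp w w|.
    rewrite -{1}(gtr0_norm sum_gt0) -normrM -subr_sqr YE.
    by congr (`|_|); ring.
  rewrite -(ler_pM2r sum_gt0) prodE.
  apply: le_trans (ler_normD _ _) _; rewrite normrM gtr0_norm; last by lra.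
  have : 2 * t * `|dotp theta w| <= 2 * t * d%:R by rewrite ler_pM2l //; lra.
  by nra.
have Y_gt : t - C < Y by move: Yt; rewrite ler_norml /C => /andP[]; lra.
have Y_r : r < Y by have := ler_norm r; move: Y_gt; rewrite /t; lra.
have Y_gt0 : 0 < Y by have := normr_ge0 r; move: Y_gt; rewrite /t; lra.
exists a; split => //.
have -> : direction a - theta = Y^-1 *: (w + (t - Y) *: theta).
  rewrite /direction -/Y posE; apply/rowP => i; rewrite !mxE.
  by field; rewrite lt0r_neq0.
rewrite normrZ gtr0_norm ?invr_gt0 // mulrC ltr_pdivrMr //.
have num_le : `|w + (t - Y) *: theta| <= C.
  apply: le_trans (ler_normD _ _) _; apply: lerD.
    by apply: norm_rV_le.
  rewrite normrZ distrC; apply: le_trans Yt; rewrite ler_piMr //.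
  by apply: norm_rV_le.
apply: le_lt_trans num_le _; rewrite mulrC -ltr_pdivrMr //.
by have := normr_ge0 r; move: Y_gt; rewrite /t; lra.
Qed.

Lemma dir_filter_proper (theta : 'rV[R]_d) : enorm theta = 1 ->
  ProperFilter (@dir_filter R d N theta).
Proof.
move=> theta1; apply: Build_ProperFilter_ex => A [V [r [nV rA]]].
have /nbhs_ballP[del /= del_gt0 delV] := nV.
have [a [ra a_near]] := direction_approx r theta1 del_gt0.
by exists a; apply: rA => //; apply: delV; rewrite -ball_normE /ball_ /= distrC.
Qed.

Lemma finite_lattice_ball (r : R) :
  finite_set [set a : E | enorm (position a : 'rV[R]_d) <= r].
Proof.
have [n rn] : exists n : nat, r <= n%:R.
  exists (Num.truncn `|r|).+1; apply: le_trans (ler_norm r) _.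
  by apply: ltW; have /andP[] := truncn_itv (normr_ge0 r).
pose f (z : 'rV['I_(n.*2.+1)]_d * 'I_N) : E := (\row_i ((z.1 0 i)%:Z - n%:Z), z.2).
apply: (@sub_finite_set _ _ (f @` [set: 'rV['I_(n.*2.+1)]_d * 'I_N])); last first.
  exact: finite_image.
move=> [x k] /= xr.
have x_le i : `|x 0 i| <= n%:Z.
  rewrite -(ler_int R) intr_norm; apply: le_trans rn; apply: le_trans xr.
  apply: le_trans (norm_le_enorm _); apply: le_trans (norm_coord_le _ i).
  by rewrite mxE.
exists (\row_i inord (absz (x 0 i + n%:Z)), k) => //; congr (_, _).
apply/rowP => i; rewrite !mxE inordK; have := x_le i; lia.
Qed.

(** An ultrafilter either contains a bounded, hence finite, set of lattice points, or leaves every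
    ball; its directions then converge on the compact unit sphere. *)
Lemma cat0_compact : compact [set: cat0E].
Proof.
rewrite compact_ultra => F FU _.
pose low r := [set z : cat0E | if z is inl a then enorm (position a : 'rV[R]_d) <= r
                               else False].
have low_finite r : finite_set (low r).
  apply: (@sub_finite_set _ _ (inl @` [set a : E | enorm (position a : 'rV[R]_d) <= r])).
    by move=> [a|//] ar; exists a.
  exact: finite_image (finite_lattice_ball r).
have [[r Fr]|nF] := pselect (exists r, F (low r)).
  have := finite_compact (low_finite r); rewrite compact_ultra => /(_ F FU Fr).
  by move=> [z [_ Fz]]; exists z.
have far r : F (~` low r).
  by case: (in_ultra_setVsetC (low r) FU) => // Fr; case: nF; exists r.
pose D (z : cat0E) : 'rV[R]_d := match z with inl a => direction a | inr theta => val theta end.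
have dot_cont : continuous (fun u : 'rV[R]_d => dotp u u).
  have coord i : continuous (fun u : 'rV[R]_d => u 0 i) by exact: coord_continuous.
  by apply: continuous_bigsum => i u; exact: continuousM (coord i u) (coord i u).
pose SS := [set u : 'rV[R]_d | `|u| <= 1] `&` ((fun u => dotp u u) @^-1` [set 1 : R]).
have S_compact : compact SS.
  apply: compact_closedI; first exact: compact_norm_le.
  by apply: preimage_closed (@closed_eq _ 1) => u _; exact: dot_cont.
have FS : F (D @^-1` SS).
  apply: filterS (far 0) => z /= nz.
  have Dz : enorm (D z) = 1.
    case: z nz => [a|theta] /= nz; last exact: sphere_enorm.
    by apply: enorm_direction; rewrite ltNge; exact/negP.
  split; first by rewrite -Dz; exact: norm_le_enorm.
  by rewrite /= -sqr_enorm Dz expr1n.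
have [u [[_ /= u1] uP]] := S_compact _ (fmap_proper_filter D _) (FS : (D @ F) SS).
have uS : enorm u == 1 by rewrite enormE u1 sqrtr1.
exists (inr (exist _ u uS)); split => // A [V [r [nV VA rA]]].
have FV : F (D @^-1` V).
  have [//|FnV] := in_ultra_setVsetC (D @^-1` V) FU.
  by have [z [nVz Vz]] := uP _ _ (FnV : (D @ F) (~` V)) nV.
apply: filterS (filterI FV (far r)) => -[a|theta] [/= Va nlow]; last exact: VA.
by apply: rA => //; rewrite ltNge; exact/negP.
Qed.

Lemma cat0_hausdorff : hausdorff_space cat0E.
Proof.
have inl_inr a theta : ~ cluster (nbhs (inl a : cat0E)) (inr theta).
  move=> cl; have [||z [za zt]] := cl [set inl a]
    [set z | if z is inl b then enorm (position a : 'rV[R]_d) < enorm (position b : 'rV[R]_d)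
             else True].
  - by [].
  - by exists setT, (enorm (position a : 'rV[R]_d)); split => //; exact: filterT.
  - by move: zt; rewrite za /= ltxx.
move=> [a|theta] [b|phi] cl.
- by have [||z [-> ->]] := cl [set inl a] [set inl b].
- by have := inl_inr _ _ cl.
- suff /inl_inr : cluster (nbhs (inl b : cat0E)) (inr theta) by [].
  by move=> A B nA nB; rewrite setIC; exact: cl.
congr inr; apply: val_inj; apply: (@norm_hausdorff _ _) => A B nA nB.
pose in_dir (V : set 'rV[R]_d) : set cat0E :=
  [set z | match z with inl a => V (direction a) | inr t => V (val t) end].
have in_nbhs V (t : sphere R d) : nbhs (val t) V -> nbhs (inr t : cat0E) (in_dir V).
  by move=> nV; exists V, 0; split.
have [[a|t] [Az Bz]] := cl _ _ (in_nbhs _ _ nA) (in_nbhs _ _ nB).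
  by exists (direction a).
by exists (val t).
Qed.

Lemma cat0_compactification : compactification (@cat0_embed R d N).
Proof.
split.
- exact: cat0_compact.
- exact: cat0_hausdorff.
- by move=> a b [].
- by move=> a; rewrite openE => z ->.
- move=> O [z Oz]; rewrite openE => /(_ z Oz); case: z {Oz} => [a|theta].
    by move=> Oa; exists (inl a); split => //; exists a.
  move=> [V [r [nV _ rO]]].
  have := filter_ex (FF := dir_filter_proper (sphere_enorm theta)).
  have : dir_filter (val theta) [set a : E | O (inl a)] by exists V, r.
  by move=> h /(_ _ h)[a Oa]; exists (inl a); split => //; exists a.
Qed.

Definition cat0_extend (K : E -> E -> R) (Kinf : sphere R d -> E -> R) (x : E) (z : cat0E) : R :=
  match z with inl y => K x y | inr theta => Kinf theta x end.

Lemma cat0_extension (K : E -> E -> R) (Kinf : sphere R d -> E -> R) :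
  (forall theta x, K x y @[y --> dir_filter (val theta)] --> Kinf theta x) ->
  continuous_extension K (@cat0_embed R d N) (cat0_extend K Kinf).
Proof.
move=> lim; split => // x [y|theta].
  by move=> A nA; exact: (nbhs_singleton nA).
have FF : Filter (nbhs (inr theta : cat0E)) by exact: nbhs_filter.
apply/(@cvgrPdist_le _ _ _ _ FF) => ep ep_gt0.
have /cvgrPdist_le/(_ _ ep_gt0)[V [r [nV rV]]] := lim theta x.
exists V°, r; split; first exact: nbhs_interior.
  (* Neighbourhoods of [theta] also contain points [phi] at infinity; their values are limits of
     kernel values at lattice points that already satisfy the bound. *)
  move=> phi Vphi /=; apply/ler_addgt0Pr => eta eta_gt0.
  have PF := dir_filter_proper (sphere_enorm phi).
  have /cvgrPdist_le/(_ _ eta_gt0) near_phi := lim phi x.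
  have near_V : \forall a \near dir_filter (val phi), `|Kinf theta x - K x a| <= ep.
    by exists V, r.
  have [a [Ka Va]] := filter_ex (filterI near_phi near_V).
  rewrite -[X in `|X|](subrKA (K x a)); apply: le_trans (ler_normD _ _) _.
  by rewrite lerD // distrC.
by move=> a ra Va; apply: rV => //; exact: interior_subset.
Qed.

(** Injectivity of [Kinf] is exactly the separation of boundary points that [compactification_map]
    needs. *)
Lemma cat0_martin (p : E -> E -> R) (x0 : E) (Kinf : sphere R d -> E -> R) :
  (forall theta x, martin_kernel p x0 x y @[y --> dir_filter (val theta)] --> Kinf theta x) ->
  injective Kinf ->
  martin_compactification p x0 (@cat0_embed R d N)
    (cat0_extend (martin_kernel p x0) Kinf).
Proof.
move=> lim inj; have ext := cat0_extension lim.
split => [||M' iota' Kt' cM' eM'] //; first exact: cat0_compactification.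
apply: (compactification_map cat0_compactification cM' ext eM').
move=> [a|th1]; first by move=> xi2 bd1; case: bd1; exists a.
move=> [b|th2] bd1 bd2 E12; first by case: bd2; exists b.
by congr inr; apply: inj; exact: funext.
Qed.

End Cat0.

Theorem theorem1p2 (R : realType) (d N : nat) (d_ge1 : (1 <= d)%N)
    (N_ge1 : (1 <= N)%N) (p : thick d N -> thick d N -> R)
    (p_markov : markov_kernel p) (p_irreducible : irreducible_kernel p)
    (p_invariant : lattice_invariant p) (p_finite : finitely_supported p)
    (nu0 : 'I_N -> R) (nu0_stationary : stationary_probability (induced_chain p) nu0)
    (p_noncentered : drift p nu0 <> 0)
    (x0 : thick d N) :
  green_finite p /\
  (exists (M : topologicalType) (iota : thick d N -> M)
     (Kt : thick d N -> M -> R), martin_compactification p x0 iota Kt) /\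
  (forall (M : topologicalType) (iota : thick d N -> M)
     (Kt : thick d N -> M -> R), martin_compactification p x0 iota Kt ->
     coincide iota (@cat0_embed R d N) /\
     (forall xi : M, ~ range iota xi -> minimal_harmonic p (Kt^~ xi))).
Proof.
have [green_fin [Kinf [lim inj min]]] := martin_limits x0 p_markov p_irreducible
  p_invariant p_finite nu0_stationary p_noncentered.
have cat0M := cat0_martin x0.2 lim inj.
split => //; split; first by eexists; eexists; eexists; exact: cat0M.
move=> M iota Kt mM.
have [f [g [[f_cont g_cont fg gf fE] KtE]]] := martin_compactifications_coincide mM cat0M.
split; first by exists f, g.
(* As [f] is injective and the identity on the lattice, a boundary point can only go to the
   sphere. *)
move=> xi xi_bd; case fxi : (f xi) => [a|theta].
  by case: xi_bd; exists a => //; apply: (can_inj fg); rewrite fE fxi.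
have -> : Kt^~ xi = Kinf theta by apply: funext => x; rewrite KtE fxi.
exact: min.
Qed.
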